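(* Let $\theta,\omega\in H^\infty$ be inner functions with $\theta(0)=0$ and $\omega(0)=0$, and let $g\in H^2$ be a multiplier between $\mathcal K_\theta$ and $\mathcal K_\omega$. Let $g_1\in H^2$ be the function with $g=\omega\overline\theta\,\overline{g_1}$ a.e. on $\mathbb T$, and let $X\in\mathcal L(\mathcal K_\theta,\mathcal K_\omega)$ be $Xf=gf$, $f\in\mathcal K_\theta$. Suppose $g_1(0)\neq0$. Let $c\in\mathbb T$ and put $$u=\omega+\frac{1}{\overline{g_1(0)}}(c-\theta)g .$$ Then $u\in\mathcal K_\omega$, and with $T=S_\omega+(\cdot,\overline\chi\omega)u$ we have $XU_{(\theta)c}=TX$.
   Context: $m$ is normalized Lebesgue measure on $\mathbb T$; $H^2$ is the Hardy space of $\mathbb D$, identified with a subspace of $L^2(m)$ via boundary values, with the $L^2(m)$ inner product. $\chi(z)=z$, $\mathbf 1(z)=1$. For inner $\theta$, $\mathcal K_\theta=H^2\ominus\theta H^2$; $S$ is multiplication by $\chi$ on $H^2$ and $S_\theta=P_{\mathcal K_\theta}S|_{\mathcal K_\theta}$. $\overline\chi\theta$ is the function $\zeta\mapsto\overline\zeta\theta(\zeta)$ on $\mathbb T$ (in $\mathcal K_\theta$ when $\theta(0)=0$). $(\cdot,v)u$ is the operator $f\mapsto(f,v)u$. For $\theta(0)=0$, $c\in\mathbb T$: $U_{(\theta)c}=S_\theta+c(\cdot,\overline\chi\theta)\mathbf 1\in\mathcal L(\mathcal K_\theta)$. A function $g\in H^2$ is a multiplier between $\mathcal K_\theta$ and $\mathcal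 K_\omega$ if $gf\in\mathcal K_\omega$ for every $f\in\mathcal K_\theta$ (then $f\mapsto gf$ is bounded, and there exists $g_1\in H^2$ with $g=\omega\overline\theta\,\overline{g_1}$ a.e. on $\mathbb T$). *)

(* Defs.v *)
(* Functions on the unit circle T are represented
   through the parametrisation t |-> e^{it}, t in [0, 2pi]; normalized
   Lebesgue measure m on T becomes (1/(2 pi)) dt on [0, 2pi]. *)
From HB Require Import structures.
From mathcomp Require Import all_boot all_order all_algebra.
From mathcomp Require Import all_classical all_reals all_analysis.
From mathcomp Require Import complex.
Set Implicit Arguments. Unset Strict Implicit. Unset Printing Implicit Defensive.
Import Order.TTheory GRing.Theory Num.Theory.
Local Open Scope ring_scope.
Local Open Scope classical_set_scope.

Section Hardy.
Variable R : realType.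
Local Notation C := R[i].
Local Notation mu := (@lebesgue_measure R).

Definition Tdom : set R := `[0, 2 * pi].

Definition bfun := R -> C.

Definition expi (n : int) : bfun :=
  fun t => Complex (cos (n%:~R * t)) (sin (n%:~R * t)).

Definition chi : bfun := expi 1.
Definition one : bfun := fun _ => 1.

Definition Tint (f : bfun) : C :=
  Complex ((2 * pi)^-1 * Rintegral mu Tdom (fun t => complex.Re (f t)))
          ((2 * pi)^-1 * Rintegral mu Tdom (fun t => complex.Im (f t))).

Definition L2 (f : bfun) : Prop :=
  measurable_fun Tdom (fun t => complex.Re (f t)) /\
  measurable_fun Tdom (fun t => complex.Im (f t)) /\
  mu.-integrable Tdom (fun t => ((complex.Re (f t)) ^+ 2 + (complex.Im (f t)) ^+ 2)%:E).

Definition ip (f h : bfun) : C := Tint (fun t => f t * conjc (h t)).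

Definition fcoef (f : bfun) (n : int) : C :=
  Tint (fun t => f t * expi (- n) t).

(* H^2, identified with the subspace of L^2(m) of boundary values *)
Definition H2 (f : bfun) : Prop :=
  L2 f /\ forall n : int, (n < 0)%R -> fcoef f n = 0.

(* value at 0 of the analytic extension of f in H^2 *)
Definition at0 (f : bfun) : C := fcoef f 0.

Definition inner (th : bfun) : Prop :=
  H2 th /\
  (exists M : R, {ae mu, forall t, Tdom t -> `|th t| <= (M%:C)%C}) /\
  {ae mu, forall t, Tdom t -> `|th t| = 1}.

Definition Kspace (th : bfun) (f : bfun) : Prop :=
  H2 f /\ forall h, H2 h -> ip f (fun t => th t * h t) = 0.

(* k is (a representative of) the orthogonal projection of h onto K *)
Definition is_proj (K : bfun -> Prop) (h k : bfun) : Prop :=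
  K k /\ forall v, K v -> ip (fun t => h t - k t) v = 0.

Definition aeeq (f h : bfun) : Prop := {ae mu, forall t, Tdom t -> f t = h t}.

Definition multiplier (th om g : bfun) : Prop :=
  H2 g /\ forall f, Kspace th f -> Kspace om (fun t => g t * f t).

Definition chibar_th (th : bfun) : bfun := fun t => conjc (chi t) * th t.

(* k = S_theta f + c (f, chibar theta) 1, given that k0 = P_{K_theta}(chi f) *)
Definition Uc_val (th : bfun) (c : C) (f k0 : bfun) : bfun :=
  fun t => k0 t + c * ip f (chibar_th th) * one t.

(* T h = S_omega h + (h, chibar omega) u, given k0 = P_{K_omega}(chi h) *)
Definition T_val (om u : bfun) (h k0 : bfun) : bfun :=
  fun t => k0 t + ip h (chibar_th om) * u t.

End Hardy.

(* Main.v *)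
(* For theta(0) = 0, the compressed shift is explicit: S_theta f = chi f -
   (f, conj(chi) theta) theta, because chi f is orthogonal to theta chi H^2.
   Writing g = omega conj(theta) conj(g1) and g1 = g1(0) + chi h gives
   (g f, conj(chi) omega) = conj(g1(0)) (f, conj(chi) theta), and the
   intertwining relation becomes an identity between boundary values.
   For u in K_omega, theta g = chi (g conj(chi) theta) lies in H^2 since
   conj(chi) theta belongs to K_theta, and g = g 1 lies in K_omega since
   1 belongs to K_theta.

   The last membership says that theta h has mean zero for every h in H^2, and
   needs the L^2-density of trigonometric polynomials: if a trigonometric
   polynomial p is close to theta, so is its part p+ with positive frequencies,
   and p+ h has mean zero.  The density is obtained from closure of the
   trigonometric polynomials under bounded pointwise limits: this class is an
   algebra stable under taking signs of functions bounded by 1, so it contains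
   the indicators of the intervals ]0, x[, hence of all Borel sets. *)
Require Import Defs.
From HB Require Import structures.
From mathcomp Require Import all_boot all_order all_algebra.
From mathcomp Require Import all_classical all_reals all_analysis.
From mathcomp Require Import complex measurable_realfun ring lra zify.
Set Implicit Arguments. Unset Strict Implicit. Unset Printing Implicit Defensive.
Import Order.TTheory GRing.Theory Num.Theory.
Import numFieldNormedType.Exports.
Local Open Scope ring_scope.
Local Open Scope classical_set_scope.

(** * Complex-valued integrals on the circle *)

Section ComplexParts.
Variable R : realType.
Implicit Types z w : R[i].

(** The squared modulus, taken in [R] because the norm on [R[i]] takes its values in [R[i]]. *)
Definition nsq z : R := complex.Re z ^+ 2 + complex.Im z ^+ 2.

Lemma complexP z w :
  complex.Re z = complex.Re w -> complex.Im z = complex.Im w -> z = w.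
Proof. by case: z w => [a b] [c d] /= -> ->. Qed.

Lemma ReD z w : complex.Re (z + w) = complex.Re z + complex.Re w.
Proof. by case: z w => [a b] [c d]. Qed.

Lemma ImD z w : complex.Im (z + w) = complex.Im z + complex.Im w.
Proof. by case: z w => [a b] [c d]. Qed.

Lemma ReM z w : complex.Re (z * w) =
  complex.Re z * complex.Re w - complex.Im z * complex.Im w.
Proof. by case: z w => [a b] [c d]. Qed.

Lemma ImM z w : complex.Im (z * w) =
  complex.Re z * complex.Im w + complex.Im z * complex.Re w.
Proof. by case: z w => [a b] [c d]. Qed.

Lemma ReJ z : complex.Re (conjc z) = complex.Re z.
Proof. by case: z. Qed.

Lemma ImJ z : complex.Im (conjc z) = - complex.Im z.
Proof. by case: z. Qed.

Lemma ReN z : complex.Re (- z) = - complex.Re z.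
Proof. by case: z. Qed.

Lemma ImN z : complex.Im (- z) = - complex.Im z.
Proof. by case: z. Qed.

Definition ReImE := (ReD, ImD, ReM, ImM, ReJ, ImJ, ReN, ImN).

Lemma conjM z w : conjc (z * w) = conjc z * conjc w.
Proof. by apply: complexP; rewrite !ReImE; ring. Qed.

Lemma conjD z w : conjc (z + w) = conjc z + conjc w.
Proof. by apply: complexP; rewrite !ReImE; ring. Qed.

Lemma conjN z : conjc (- z) = - conjc z.
Proof. by apply: complexP; rewrite !ReImE. Qed.

(** With [a, b] and [c, d] the parts of two complex numbers, this dominates the real part of their
    product by the sum of their squared moduli, so a product of two [L2] functions is integrable. *)
Lemma norm_cross_le (a b c d : R) :
  `|a * c - b * d| <= a ^+ 2 + b ^+ 2 + (c ^+ 2 + d ^+ 2).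
Proof.
have := sqr_ge0 (a - c); have := sqr_ge0 (a + c).
have := sqr_ge0 (b - d); have := sqr_ge0 (b + d).
by rewrite ler_norml => *; apply/andP; split; nra.
Qed.

Lemma nsq_ge0 z : 0 <= nsq z.
Proof. by rewrite /nsq addr_ge0 ?sqr_ge0. Qed.

Lemma nsqM z w : nsq (z * w) = nsq z * nsq w.
Proof. by rewrite /nsq !ReImE; ring. Qed.

Lemma nsqJ z : nsq (conjc z) = nsq z.
Proof. by rewrite /nsq !ReImE; ring. Qed.

Lemma nsqD_le z w : nsq (z + w) <= 2 * nsq z + 2 * nsq w.
Proof.
rewrite /nsq !ReImE.
have := sqr_ge0 (complex.Re z - complex.Re w).
by have := sqr_ge0 (complex.Im z - complex.Im w); nra.
Qed.

Lemma nsq_eq0 z : nsq z = 0 -> z = 0.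
Proof.
move=> /eqP; rewrite /nsq paddr_eq0 ?sqr_ge0// !sqrf_eq0 => /andP[/eqP a /eqP b].
exact: complexP.
Qed.

Lemma mulJ_nsq z : z * conjc z = (nsq z)%:C%C.
Proof. by apply: complexP; rewrite !ReImE /nsq /=; ring. Qed.

Lemma nsq_normc z : `|z| = 1 -> nsq z = 1.
Proof. by move=> z1; apply/(@complexI R); rewrite /nsq add_Re2_Im2 z1 expr1n. Qed.

End ComplexParts.

(** * Measurability, integrability and the inner product on the circle *)

Section Integration.
Variable R : realType.
Local Notation C := R[i].
Local Notation mu := (@lebesgue_measure R).
Local Notation Tdom := (@Defs.Tdom R).
Implicit Types f h q : bfun R.

Definition cmeas f := measurable_fun Tdom (fun t => complex.Re (f t)) /\
  measurable_fun Tdom (fun t => complex.Im (f t)).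

Definition cintegrable f :=
  mu.-integrable Tdom (EFin \o (fun t => complex.Re (f t))) /\
  mu.-integrable Tdom (EFin \o (fun t => complex.Im (f t))).

(** The squared norm for unnormalized Lebesgue measure; [ip_sqn] restores the factor
    [(2 * pi)^-1]. *)
Definition sqn f : R := (\int[mu]_(t in Tdom) nsq (f t))%R.

Lemma measurable_Tdom : measurable Tdom.
Proof. exact: measurable_itv. Qed.
Hint Resolve measurable_Tdom : core.

Lemma mu_Tdom : mu Tdom = (2 * pi)%:E.
Proof.
rewrite /Defs.Tdom lebesgue_measure_itv/= lte_fin.
by rewrite mulr_gt0 ?pi_gt0// sube0.
Qed.

Lemma ae_Tdom (P Q : R -> Prop) : (forall t, Tdom t -> P t -> Q t) ->
  {ae mu, forall t, Tdom t -> P t} -> {ae mu, forall t, Tdom t -> Q t}.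
Proof.
move=> PQ; apply: (@filterS _ _ (ae_filter_ringOfSetsType mu)) => t h Dt.
exact: PQ (h Dt).
Qed.

Lemma ae_Tdom2 (P P' Q : R -> Prop) : (forall t, Tdom t -> P t -> P' t -> Q t) ->
  {ae mu, forall t, Tdom t -> P t} -> {ae mu, forall t, Tdom t -> P' t} ->
  {ae mu, forall t, Tdom t -> Q t}.
Proof.
move=> PQ; apply: (@filterS2 _ _ (ae_filter_ringOfSetsType mu)) => t h h' Dt.
exact: PQ (h Dt) (h' Dt).
Qed.

Lemma ae_TdomE (P : R -> Prop) : {ae mu, forall t, Tdom t -> P t} ->
  exists N : set R, [/\ measurable N, mu N = 0%E &
    forall t, Tdom t -> ~ N t -> P t].
Proof.
move=> [N [mN N0 PN]]; exists N; split=> // t Dt Nt.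
by apply: contrapT => Pt; apply: Nt; apply: PN => /(_ Dt).
Qed.

Lemma L2P f : L2 f <-> cmeas f /\ mu.-integrable Tdom (EFin \o (fun t => nsq (f t))).
Proof. by split => [[? [? ?]]|[[? ?] ?]]. Qed.

Lemma L2_cmeas f : L2 f -> cmeas f.
Proof. by case/L2P. Qed.

Lemma L2_sqn f : L2 f -> mu.-integrable Tdom (EFin \o (fun t => nsq (f t))).
Proof. by case/L2P. Qed.

Lemma cmeasD f h : cmeas f -> cmeas h -> cmeas (fun t => f t + h t).
Proof.
move=> [fr fi] [hr hi]; split.
- by under eq_fun do rewrite ReD; exact: measurable_funD.
- by under eq_fun do rewrite ImD; exact: measurable_funD.
Qed.

Lemma cmeasM f h : cmeas f -> cmeas h -> cmeas (fun t => f t * h t).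
Proof.
move=> [fr fi] [hr hi]; split.
- by under eq_fun do rewrite ReM; apply: measurable_funB; exact: measurable_funM.
- by under eq_fun do rewrite ImM; apply: measurable_funD; exact: measurable_funM.
Qed.

Lemma cmeasJ f : cmeas f -> cmeas (fun t => conjc (f t)).
Proof.
move=> [fr fi]; split.
- by under eq_fun do rewrite ReJ.
- by under eq_fun do rewrite ImJ; exact: measurableT_comp.
Qed.

Lemma cmeas_cst (a : C) : cmeas (fun=> a).
Proof. by split; exact: measurable_cst. Qed.

Lemma measurable_nsq f : cmeas f -> measurable_fun Tdom (fun t => nsq (f t)).
Proof. by move=> [fr fi]; apply: measurable_funD; exact: measurable_funX. Qed.

Lemma integrable_le (f g : R -> R) : measurable_fun Tdom f ->
  (forall t, Tdom t -> `|f t| <= g t) -> mu.-integrable Tdom (EFin \o g) ->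
  mu.-integrable Tdom (EFin \o f).
Proof.
move=> mf fg; apply: le_integrable => //; first exact/measurable_EFinP.
by move=> t Dt /=; rewrite lee_fin (le_trans (fg t Dt))// ler_norm.
Qed.

Lemma integrableRZ (a : R) (f : R -> R) : mu.-integrable Tdom (EFin \o f) ->
  mu.-integrable Tdom (EFin \o (fun t => a * f t)).
Proof.
move=> fi; have -> : EFin \o (fun t => a * f t) = (fun t => a%:E * (EFin \o f) t)%E.
  by apply/funext => t; rewrite /= -EFinM.
exact: integrableZl.
Qed.

Lemma integrable_lin (a b : R) (f g : R -> R) :
  mu.-integrable Tdom (EFin \o f) -> mu.-integrable Tdom (EFin \o g) ->
  mu.-integrable Tdom (EFin \o (fun t => a * f t + b * g t)).
Proof.
move=> fi gi.
have -> : EFin \o (fun t => a * f t + b * g t) =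
    ((EFin \o (fun t => a * f t)%R) \+ (EFin \o (fun t => b * g t)%R))%E.
  by apply/funext => t; rewrite /= -EFinD.
by apply: integrableD => //; exact: integrableRZ.
Qed.

Lemma Rintegral_lin (a b : R) (f g : R -> R) :
  mu.-integrable Tdom (EFin \o f) -> mu.-integrable Tdom (EFin \o g) ->
  (\int[mu]_(t in Tdom) (a * f t + b * g t) =
   a * \int[mu]_(t in Tdom) f t + b * \int[mu]_(t in Tdom) g t)%R.
Proof.
move=> fi gi; rewrite RintegralD// ?RintegralZl//; exact: integrableRZ.
Qed.

Lemma Rintegral_aeeq (f g : R -> R) :
  measurable_fun Tdom f -> measurable_fun Tdom g ->
  {ae mu, forall t, Tdom t -> f t = g t} ->
  (\int[mu]_(t in Tdom) f t = \int[mu]_(t in Tdom) g t)%R.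
Proof.
move=> mf mg fg; congr fine; apply: ae_eq_integral => //.
- exact/measurable_EFinP.
- exact/measurable_EFinP.
- by apply: ae_Tdom fg => t _ /= ->.
Qed.

Lemma cintegrableM f h : L2 f -> L2 h -> cintegrable (fun t => f t * h t).
Proof.
move=> /L2P[mf fi] /L2P[mh hi].
have [mr mi] := cmeasM mf mh.
have gi := integrable_lin 1 1 fi hi.
split; apply: integrable_le gi => // t _; rewrite !ReImE !mul1r /nsq.
- exact: norm_cross_le.
(* The imaginary part has the same cross form once [Im f] changes sign and the two parts of [h] are
   exchanged. *)
- have := norm_cross_le (complex.Re (f t)) (- complex.Im (f t))
    (complex.Im (h t)) (complex.Re (h t)).
  by rewrite mulNr opprK sqrrN; lra.
Qed.

Lemma L2J f : L2 f -> L2 (fun t => conjc (f t)).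
Proof.
move=> /L2P[mf fi]; apply/L2P; split; first exact: cmeasJ.
by under eq_fun do rewrite nsqJ.
Qed.

Lemma cintegrable_ip f h : L2 f -> L2 h -> cintegrable (fun t => f t * conjc (h t)).
Proof. by move=> Lf Lh; apply: cintegrableM => //; exact: L2J. Qed.

Lemma L2D f h : L2 f -> L2 h -> L2 (fun t => f t + h t).
Proof.
move=> /L2P[mf fi] /L2P[mh hi]; have mfh := cmeasD mf mh.
apply/L2P; split => //.
apply: integrable_le (integrable_lin 2 2 fi hi); first exact: measurable_nsq.
by move=> t _; rewrite ger0_norm ?nsq_ge0// nsqD_le.
Qed.

Lemma L2M q h (M : R) : cmeas q ->
  {ae mu, forall t, Tdom t -> nsq (q t) <= M} ->
  L2 h -> L2 (fun t => q t * h t).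
Proof.
move=> mq /ae_TdomE[N [mN N0 qN]] /L2P[mh hi]; have mqh := cmeasM mq mh.
apply/L2P; split => //.
have mi : measurable_fun Tdom (EFin \o (fun t => nsq (q t * h t))).
  by apply/measurable_EFinP; exact: measurable_nsq mqh.
(* Removing the null set [N] does not affect integrability, and off [N] the bound on [q] holds at
   every point. *)
apply: (@negligible_integrable _ _ _ mu _ _ _ mN measurable_Tdom mi N0).2.
have hi' := (@negligible_integrable _ _ _ mu _ _ _ mN measurable_Tdom (measurable_int _ hi) N0).1 hi.
have mDN : measurable (Tdom `\` N) by exact: measurableD.
have gi := @integrableZl _ _ _ mu _ mDN `|M| _ hi'.
refine (@le_integrable _ _ _ mu _ mDN _ _ _ _ gi).
  apply: (measurable_funS measurable_Tdom); first exact: subDsetl.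
  by apply/measurable_EFinP; exact: measurable_nsq mqh.
move=> t [Dt Nt] /=; rewrite lee_fin nsqM.
have qM := qN t Dt Nt; rewrite !normrM normr_id ler_wpM2r// ger0_norm ?nsq_ge0//.
exact: le_trans qM (ler_norm _).
Qed.

Lemma L2Z (a : C) f : L2 f -> L2 (fun t => a * f t).
Proof.
apply: (@L2M (fun=> a) f (nsq a)); first exact: cmeas_cst.
exact: nearW.
Qed.

Lemma L2_cst (a : C) : L2 (fun=> a).
Proof.
apply/L2P; split; first exact: cmeas_cst.
apply/integrableP; split; first exact/measurable_EFinP.
have muT : (mu Tdom < +oo)%E by rewrite mu_Tdom ltry.
by rewrite integral_cst//= lte_mul_pinfty.
Qed.

Lemma cintegrableL2 f : L2 f -> cintegrable f.
Proof.
move=> Lf; have := cintegrableM Lf (L2_cst 1).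
by under eq_fun do rewrite mulr1.
Qed.

Lemma cintegrableZ (a : C) f : cintegrable f -> cintegrable (fun t => a * f t).
Proof.
move=> [fr fi]; split.
- under eq_fun do rewrite ReM.
  under eq_fun do rewrite -mulNr.
  exact: integrable_lin.
- under eq_fun do rewrite ImM.
  exact: integrable_lin.
Qed.

Lemma TintD f h : cintegrable f -> cintegrable h ->
  Tint (fun t => f t + h t) = Tint f + Tint h.
Proof.
move=> [fr fi] [hr hi]; apply: complexP; rewrite ReImE/=.
- rewrite -mulrDr -RintegralD//; congr (_ * _); apply: eq_Rintegral => t _.
  by rewrite ReD.
- rewrite -mulrDr -RintegralD//; congr (_ * _); apply: eq_Rintegral => t _.
  by rewrite ImD.
Qed.

Lemma TintZ (a : C) f : cintegrable f -> Tint (fun t => a * f t) = a * Tint f.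
Proof.
move=> [fr fi]; apply: complexP; rewrite ReImE/=.
- rewrite mulrCA (mulrCA (complex.Im a)) -mulrBr -mulNr -Rintegral_lin//.
  by congr (_ * _); apply: eq_Rintegral => t _; rewrite ReM mulNr.
- rewrite mulrCA (mulrCA (complex.Im a)) -mulrDr -Rintegral_lin//.
  by congr (_ * _); apply: eq_Rintegral => t _; rewrite ImM.
Qed.

Lemma TintJ f : cintegrable f -> Tint (fun t => conjc (f t)) = conjc (Tint f).
Proof.
move=> [fr fi]; apply: complexP; rewrite !ReImE/=.
- by congr (_ * _); apply: eq_Rintegral => t _; rewrite ReJ.
- under eq_Rintegral do rewrite ImJ -mulN1r.
  by rewrite RintegralZl// mulN1r mulrN.
Qed.

Lemma Tint_aeeq f h : cmeas f -> cmeas h -> aeeq f h -> Tint f = Tint h.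
Proof.
move=> [fr fi] [hr hi] fh; rewrite /Tint; congr (Complex (_ * _) (_ * _));
  apply: Rintegral_aeeq => //; by apply: ae_Tdom fh => t _ ->.
Qed.

Lemma ipD f f' h : L2 f -> L2 f' -> L2 h ->
  ip (fun t => f t + f' t) h = ip f h + ip f' h.
Proof.
move=> Lf Lf' Lh; rewrite /ip -TintD; try exact: cintegrable_ip.
by congr Tint; apply/funext => t; rewrite mulrDl.
Qed.

Lemma ipZ (a : C) f h : L2 f -> L2 h -> ip (fun t => a * f t) h = a * ip f h.
Proof.
move=> Lf Lh; rewrite /ip -TintZ; last exact: cintegrable_ip.
by congr Tint; apply/funext => t; rewrite mulrA.
Qed.

Lemma ipJ f h : L2 f -> L2 h -> ip h f = conjc (ip f h).
Proof.
move=> Lf Lh; rewrite /ip -TintJ; last exact: cintegrable_ip.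
by congr Tint; apply/funext => t; rewrite conjM conjcK mulrC.
Qed.

Lemma ipDr f h h' : L2 f -> L2 h -> L2 h' ->
  ip f (fun t => h t + h' t) = ip f h + ip f h'.
Proof.
move=> Lf Lh Lh'; rewrite ipJ ?ipD ?conjD -?ipJ//; exact: L2D.
Qed.

Lemma ipZr (a : C) f h : L2 f -> L2 h ->
  ip f (fun t => a * h t) = conjc a * ip f h.
Proof.
by move=> Lf Lh; rewrite ipJ ?ipZ ?conjM -?ipJ//; exact: L2Z.
Qed.

Lemma L2B f h : L2 f -> L2 h -> L2 (fun t => f t - h t).
Proof.
move=> Lf Lh; have := L2D Lf (L2Z (-1) Lh).
by under eq_fun do rewrite mulN1r.
Qed.

Lemma ipB f f' h : L2 f -> L2 f' -> L2 h ->
  ip (fun t => f t - f' t) h = ip f h - ip f' h.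
Proof.
move=> Lf Lf' Lh; rewrite -mulN1r -ipZ// -ipD//; last exact: L2Z.
by under [in RHS]eq_fun do rewrite mulN1r.
Qed.

Lemma ipBr f h h' : L2 f -> L2 h -> L2 h' ->
  ip f (fun t => h t - h' t) = ip f h - ip f h'.
Proof.
move=> Lf Lh Lh'; rewrite [LHS]ipJ//; last exact: L2B.
by rewrite ipB// conjD conjN -(ipJ Lh Lf) -(ipJ Lh' Lf).
Qed.

Lemma ip_sqn f : ip f f = ((2 * pi)^-1 * sqn f)%:C%C.
Proof.
apply: complexP => /=.
- by under eq_Rintegral do rewrite mulJ_nsq.
- under eq_Rintegral do rewrite mulJ_nsq.
  by rewrite Rintegral_cst// mul0r mulr0.
Qed.

Lemma sqn_ge0 f : 0 <= sqn f.
Proof. by apply: Rintegral_ge0 => t _; exact: nsq_ge0. Qed.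

Lemma ip_eq0_aeeq f : L2 f -> ip f f = 0 -> aeeq f (fun=> 0).
Proof.
move=> /L2P[mf fi]; rewrite ip_sqn => -[/eqP]; rewrite mulf_eq0 invr_eq0.
rewrite gt_eqF ?mulr_gt0 ?pi_gt0//= => /eqP f0.
have : (\int[mu]_(t in Tdom) `|(EFin \o (fun t => nsq (f t))) t| = 0)%E.
  under eq_integral do rewrite /= ger0_norm ?nsq_ge0//.
  by rewrite -[LHS]fineK ?(integrable_fin_num _ fi)//; exact: congr1 f0.
move/ae_eq_integral_abs => /(_ measurable_Tdom (measurable_int _ fi)).
by apply: ae_Tdom => t _ [] /nsq_eq0.
Qed.

End Integration.

(** * Fourier coefficients and the Hardy space *)

Section Exponentials.
Variable R : realType.
Local Notation C := R[i].
Local Notation mu := (@lebesgue_measure R).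
Local Notation Tdom := (@Defs.Tdom R).
Implicit Types (f h : bfun R) (n m : int).

Lemma expiD n m (t : R) : expi (n + m) t = expi n t * expi m t.
Proof.
by apply: complexP; rewrite !ReImE/= intrD mulrDl ?cosD ?sinD//; ring.
Qed.

Lemma expi0 (t : R) : expi 0 t = 1.
Proof. by apply: complexP; rewrite /= mul0r ?cos0 ?sin0. Qed.

Lemma expiJ n (t : R) : conjc (expi n t) = expi (- n) t.
Proof. by apply: complexP; rewrite !ReImE/= mulrNz mulNr ?cosN ?sinN. Qed.

Lemma nsq_expi n (t : R) : nsq (expi n t) = 1.
Proof. exact: cos2Dsin2. Qed.

Lemma continuous_lin_cos (a b : R) : continuous (fun t : R => cos (a * t + b)).
Proof.
move=> t; apply: (@continuous_comp _ _ _ (fun t => a * t + b) cos); last exact: continuous_cos.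
apply: continuousD; last exact: cst_continuous.
by apply: continuousM; [exact: cst_continuous|exact: cvg_id].
Qed.

Lemma continuous_lin_sin (a b : R) : continuous (fun t : R => sin (a * t + b)).
Proof.
move=> t; apply: (@continuous_comp _ _ _ (fun t => a * t + b) sin); last exact: continuous_sin.
apply: continuousD; last exact: cst_continuous.
by apply: continuousM; [exact: cst_continuous|exact: cvg_id].
Qed.

Lemma measurable_lin_cos (a b : R) : measurable_fun Tdom (fun t : R => cos (a * t + b)).
Proof.
apply: measurable_funTS; apply: continuous_measurable_fun; exact: continuous_lin_cos.
Qed.

Lemma measurable_lin_sin (a b : R) : measurable_fun Tdom (fun t : R => sin (a * t + b)).
Proof.
apply: measurable_funTS; apply: continuous_measurable_fun; exact: continuous_lin_sin.
Qed.

Lemma cmeas_expi n : cmeas (@expi R n).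
Proof.
split.
- have := measurable_lin_cos n%:~R 0.
  by under eq_fun do rewrite addr0.
- have := measurable_lin_sin n%:~R 0.
  by under eq_fun do rewrite addr0.
Qed.

Lemma cos_int2pi n : cos (n%:~R * (2 * pi)) = 1 :> R.
Proof.
have cN (k : nat) : cos (k%:R * (2 * pi)) = 1 :> R.
  elim: k => [|k IH]; first by rewrite mul0r cos0.
  rewrite -natr1 mulrDl mul1r (_ : 2 * pi = pi *+ 2 :> R) ?cosD2pi; last by rewrite mulr_natl.
  by rewrite -[pi *+ 2]mulr_natl.
by case: n => k; rewrite ?NegzE ?mulrNz ?mulNr ?cosN cN.
Qed.

Lemma sin_int2pi n : sin (n%:~R * (2 * pi)) = 0 :> R.
Proof.
have := cos2Dsin2 (n%:~R * (2 * pi) : R); rewrite cos_int2pi expr1n.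
by move/eqP; rewrite -subr_eq0 addrC addKr sqrf_eq0 => /eqP.
Qed.

Lemma Rintegral_cos n : n != 0 -> (\int[mu]_(t in Tdom) cos (n%:~R * t) = 0)%R.
Proof.
move=> n0; have nR : (n%:~R : R) != 0 by rewrite intr_eq0.
pose F := fun t : R => n%:~R^-1 * sin (n%:~R * t).
have dF (x : R) : is_derive x 1 F (cos (n%:~R * x)).
  by apply: is_derive_eq; rewrite /GRing.scale/=; field.
rewrite /Rintegral (@continuous_FTC2 _ _ F).
- by rewrite /F mulr0 sin0 sin_int2pi mulr0 sube0.
- by rewrite mulr_gt0 ?pi_gt0.
- apply: continuous_subspaceT => x; have := @continuous_lin_cos n%:~R 0 x.
  by under eq_fun do rewrite addr0.
- split.
  + by move=> x _; case: (dF x).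
  + by apply: cvg_at_right_filter; apply: differentiable_continuous; apply/derivable1_diffP; case: (dF 0).
  + by apply: cvg_at_left_filter; apply: differentiable_continuous; apply/derivable1_diffP; case: (dF (2 * pi)).
- by move=> x _; rewrite derive1E; case: (dF x).
Qed.

Lemma Rintegral_sin n : n != 0 -> (\int[mu]_(t in Tdom) sin (n%:~R * t) = 0)%R.
Proof.
move=> n0; have nR : (n%:~R : R) != 0 by rewrite intr_eq0.
pose F := fun t : R => - n%:~R^-1 * cos (n%:~R * t).
have dF (x : R) : is_derive x 1 F (sin (n%:~R * x)).
  by apply: is_derive_eq; rewrite /GRing.scale/=; field.
rewrite /Rintegral (@continuous_FTC2 _ _ F).
- by rewrite /F mulr0 cos0 cos_int2pi -EFinB subrr.
- by rewrite mulr_gt0 ?pi_gt0.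
- apply: continuous_subspaceT => x; have := @continuous_lin_sin n%:~R 0 x.
  by under eq_fun do rewrite addr0.
- split.
  + by move=> x _; case: (dF x).
  + by apply: cvg_at_right_filter; apply: differentiable_continuous; apply/derivable1_diffP; case: (dF 0).
  + by apply: cvg_at_left_filter; apply: differentiable_continuous; apply/derivable1_diffP; case: (dF (2 * pi)).
- by move=> x _; rewrite derive1E; case: (dF x).
Qed.

Lemma Tint_cst (a : C) : Tint (fun _ : R => a) = a.
Proof.
have pi2 : (2 * pi : R) != 0 by rewrite gt_eqF ?mulr_gt0 ?pi_gt0.
have intE (r : R) : (\int[mu]_(t in Tdom) r = r * (2 * pi))%R.
  rewrite (Rintegral_cst mu (@measurable_Tdom R)).
  by rewrite (congr1 fine (mu_Tdom R)).
by apply: complexP; rewrite /= intE mulrC mulfK.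
Qed.

Lemma Tint_expi n : Tint (@expi R n) = (n == 0)%:R.
Proof.
have [->|n0] := eqVneq n 0.
  by rewrite (_ : expi 0 = fun=> 1) ?Tint_cst//; apply/funext => t; rewrite expi0.
by apply: complexP; rewrite /= ?Rintegral_cos ?Rintegral_sin ?mulr0.
Qed.

Lemma L2_expi n : L2 (@expi R n).
Proof.
rewrite (_ : expi n = fun t => expi n t * 1); last first.
  by apply/funext => t; rewrite mulr1.
apply: (@L2M _ _ _ 1); [exact: cmeas_expi| |exact: L2_cst].
by apply: aeW => t _; rewrite nsq_expi.
Qed.

Lemma L2_expiM n f : L2 f -> L2 (fun t => expi n t * f t).
Proof.
apply: (@L2M _ _ _ 1); first exact: cmeas_expi.
by apply: aeW => t _; rewrite nsq_expi.
Qed.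

Lemma fcoef_ip f n : fcoef f n = ip f (expi n).
Proof. by rewrite /fcoef /ip; congr Tint; apply/funext => t; rewrite expiJ. Qed.

Lemma at0E f : at0 f = Tint f.
Proof.
by rewrite /at0 /fcoef; congr Tint; apply/funext => t; rewrite oppr0 expi0 mulr1.
Qed.

Lemma fcoef_expiM m f n : fcoef (fun t => expi m t * f t) n = fcoef f (n - m).
Proof.
by rewrite /fcoef; congr Tint; apply/funext => t; rewrite opprB expiD; ring.
Qed.

Lemma fcoefD f h n : L2 f -> L2 h ->
  fcoef (fun t => f t + h t) n = fcoef f n + fcoef h n.
Proof. by move=> Lf Lh; rewrite !fcoef_ip ipD//; exact: L2_expi. Qed.

Lemma fcoefZ (a : C) f n : L2 f -> fcoef (fun t => a * f t) n = a * fcoef f n.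
Proof. by move=> Lf; rewrite !fcoef_ip ipZ//; exact: L2_expi. Qed.

Lemma fcoef_expi m n : fcoef (@expi R m) n = (m == n)%:R.
Proof.
rewrite /fcoef; under eq_fun do rewrite -expiD.
by rewrite Tint_expi subr_eq0.
Qed.

Lemma fcoef_cst (a : C) n : fcoef (fun _ : R => a) n = a * (n == 0)%:R.
Proof.
have -> : (fun=> a) = (fun t : R => a * expi 0 t).
  by apply/funext => t; rewrite expi0 mulr1.
by rewrite fcoefZ ?fcoef_expi 1?eq_sym//; exact: L2_expi.
Qed.

Lemma H2_L2 f : H2 f -> L2 f. Proof. by case. Qed.

Lemma H2D f h : H2 f -> H2 h -> H2 (fun t => f t + h t).
Proof.
move=> [Lf f0] [Lh h0]; split; first exact: L2D.
by move=> n n0; rewrite fcoefD// f0// h0// addr0.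
Qed.

Lemma H2Z (a : C) f : H2 f -> H2 (fun t => a * f t).
Proof.
move=> [Lf f0]; split; first exact: L2Z.
by move=> n n0; rewrite fcoefZ// f0// mulr0.
Qed.

Lemma H2B f h : H2 f -> H2 h -> H2 (fun t => f t - h t).
Proof.
move=> Hf Hh; have := H2D Hf (H2Z (-1) Hh).
by under eq_fun do rewrite mulN1r.
Qed.

Lemma H2_expi n : 0 <= n -> H2 (@expi R n).
Proof.
move=> n0; split; first exact: L2_expi.
by move=> m m0; rewrite fcoef_expi gt_eqF// (lt_le_trans m0).
Qed.

Lemma H2_cst (a : C) : H2 (fun _ : R => a).
Proof.
split; first exact: L2_cst.
by move=> m m0; rewrite fcoef_cst lt_eqF// mulr0.
Qed.

Lemma H2_chiM f : H2 f -> H2 (fun t => chi t * f t).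
Proof.
move=> [Lf f0]; split; first exact: L2_expiM.
by move=> n n0; rewrite fcoef_expiM f0//; lia.
Qed.

(** The backward shift of $H^2$, written on boundary values. *)
Definition bshift f : bfun R := fun t => conjc (chi t) * (f t - at0 f).

Lemma chiJM (t : R) : chi t * conjc (chi t) = 1.
Proof. by rewrite expiJ -expiD subrr expi0. Qed.

Lemma bshiftE f t : f t = at0 f + chi t * bshift f t.
Proof. by rewrite /bshift mulrA chiJM mul1r addrC subrK. Qed.

Lemma H2_bshift f : H2 f -> H2 (bshift f).
Proof.
move=> Hf; have [Lf f0] := Hf; have Hb := H2B Hf (H2_cst (at0 f)).
rewrite (_ : bshift f = fun t => expi (- 1) t * (f t - at0 f)); last first.
  by apply/funext => t; rewrite /bshift expiJ.
split; first by apply: L2_expiM; exact: H2_L2.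
move=> n n0; rewrite fcoef_expiM.
(* The coefficient of index -1 comes from index 0 of [f - at0 f], which the subtraction makes zero;
   all lower ones come from negative indices. *)
have [->|n1] := eqVneq n (- 1).
  have := fcoefD 0 Lf (L2_cst (- at0 f)).
  by rewrite subrr => ->; rewrite fcoef_cst eqxx mulr1 subrr.
by apply: Hb.2; lia.
Qed.

Lemma H2_chiJM f : H2 f -> at0 f = 0 -> H2 (fun t => conjc (chi t) * f t).
Proof.
move=> /H2_bshift + f0; rewrite /bshift f0.
by under eq_fun do rewrite subr0.
Qed.

End Exponentials.

(** * Bounded pointwise limits of trigonometric polynomials *)

Section SignIteration.
Variable R : realType.

(* The Newton-Schulz iteration: its iterates are polynomials in the starting
   point that converge boundedly to the sign on [-1, 1]. *)
Definition sgstep (x : R) : R := 2^-1 * (x * (3 - x ^+ 2)).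

Lemma iter_sgstepN n x : iter n sgstep (- x) = - iter n sgstep x.
Proof. by elim: n => //= n ->; rewrite /sgstep; ring. Qed.

(** One step multiplies the error [1 - s] by [(1 - s) * (2 + s) / 2], which is at most [1 - s / 2].
    The iterates never fall below [x], so this factor stays at most [1 - x / 2] and the decay is
    geometric. *)
Lemma iter_sgstep_bounds n x : 0 < x <= 1 ->
  x <= iter n sgstep x <= 1 /\ 1 - iter n sgstep x <= (1 - x / 2) ^+ n.
Proof.
move=> /andP[x0 x1]; elim: n => [|n [/andP[xs s1] IH]].
  by rewrite /= lexx x1 expr0; split => //; lra.
have s0 := lt_le_trans x0 xs; rewrite iterS; set s := iter n _ _ in xs s1 IH s0 *.
have e1 : 1 - sgstep s = (1 - s) * ((1 - s) * (2 + s) / 2) by rewrite /sgstep; field.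
have e2 : sgstep s - s = s * (1 - s) * (1 + s) / 2 by rewrite /sgstep; field.
have f0 : 0 <= (1 - s) * (2 + s) / 2 by rewrite !mulr_ge0 ?invr_ge0//; lra.
split.
  apply/andP; split.
    apply: le_trans xs _; rewrite -subr_ge0 e2.
    by rewrite !mulr_ge0 ?invr_ge0//; lra.
  by rewrite -subr_ge0 e1 mulr_ge0//; lra.
rewrite e1 exprSr ler_pM//; first by lra.
by have := sqr_ge0 s; nra.
Qed.

Lemma iter_sgstep_norm n x : `|x| <= 1 -> `|iter n sgstep x| <= 1.
Proof.
have H y : 0 < y <= 1 -> `|iter n sgstep y| <= 1.
  move=> y01; have [/andP[ys s1] _] := iter_sgstep_bounds n y01.
  by rewrite ger0_norm//; apply: le_trans ys; case/andP: y01 => /ltW.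
rewrite ler_norml => /andP[xN1 x1]; have [x0|x0|<-] := ltgtP 0 x.
- by apply: H; rewrite x0 x1.
- by rewrite -[x]opprK iter_sgstepN normrN; apply: H; apply/andP; split; lra.
- suff -> : iter n sgstep 0 = 0 by rewrite normr0.
  by elim: n {H} => //= n ->; rewrite /sgstep mul0r mulr0.
Qed.

Lemma iter_sgstep_cvg x : `|x| <= 1 -> iter n sgstep x @[n --> \oo] --> Num.sg x.
Proof.
have H y : 0 < y <= 1 -> iter n sgstep y @[n --> \oo] --> (1 : R).
  move=> y01; have yy := y01; case/andP: yy => y0 y1.
  have e0 : (1 - y / 2) ^+ n @[n --> \oo] --> (0 : R).
    by apply: cvg_expr; rewrite ger0_norm; lra.
  have e1 : 1 - (1 - y / 2) ^+ n @[n --> \oo] --> (1 : R).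
    by rewrite -[X in _ --> X]subr0; apply: cvgB => //; exact: cvg_cst.
  apply: (squeeze_cvgr _ e1 (cvg_cst _)); apply: nearW => n.
  have [/andP[ys s1] sn] := iter_sgstep_bounds n y01.
  by rewrite s1 andbT; lra.
rewrite ler_norml => /andP[xN1 x1]; have [x0|x0|<-] := ltgtP 0 x.
- by rewrite gtr0_sg//; apply: H; rewrite x0 x1.
- rewrite ltr0_sg//.
  rewrite (_ : (fun n => iter n sgstep x) = - (fun n => iter n sgstep (- x))).
    by apply: cvgN; apply: H; apply/andP; split; lra.
  by apply/funext => n; rewrite -[LHS]opprK -iter_sgstepN.
- rewrite sgr0; apply: cvg_near_cst; apply: nearW.
  by elim=> //= n ->; rewrite /sgstep mul0r mulr0.
Qed.

(** The sum counts the positive integers up to [y], so it is the integer part of [y]. *)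
Lemma sum_steps (n : nat) (y : R) : 0 <= y <= n%:R ->
  y - 1 <= \sum_(k < n) ((k.+1%:R <= y)%R)%:R <= y.
Proof.
move=> /andP[y0 yn].
(* The induction also carries the saturated case [n <= y]: when [y] lies beyond [n], the first [n]
   terms must be known to be all 1. *)
have [_ part] : (n%:R <= y -> \sum_(k < n) ((k.+1%:R <= y)%R)%:R = n%:R :> R) /\
    (y <= n%:R -> y - 1 <= \sum_(k < n) ((k.+1%:R <= y)%R)%:R <= y).
  elim: n {yn} => [|n [IH1 IH2]].
    by rewrite big_ord0; split => // y1; apply/andP; split; lra.
  rewrite big_ord_recr /=; split.
    move=> yn; rewrite yn IH1 ?natr1//; apply: le_trans yn.
    by rewrite ler_nat.
  move=> yn; case: (leP n.+1%:R y) => [yn'|yn'] /=.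
    have yE : y = n.+1%:R by apply/eqP; rewrite eq_le yn.
    rewrite IH1; last by rewrite yE ler_nat.
    by rewrite natr1 -yE; apply/andP; split; lra.
  rewrite addr0; case: (leP y n%:R) => [/IH2//|yn2].
  rewrite IH1; last exact: ltW.
  by move: yn'; rewrite -natr1 => yn'; apply/andP; split; lra.
exact: part.
Qed.

End SignIteration.

(** * From cosines to bounded measurable functions *)

Section TrigClosure.
Variable R : realType.
Local Notation C := R[i].
Local Notation mu := (@lebesgue_measure R).
Local Notation Tdom := (@Defs.Tdom R).
Local Notation I := (`]0%R, (2 * pi : R)[ : set R).
Implicit Types (v w : R -> R).

(** The phase [b] brings in sines and constants, so the class stays real-valued. Limits may be
    iterated, and properties of the class are proved by induction on its construction. *)
Inductive trigcl : (R -> R) -> Prop :=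
| trigcl_cos (n : int) (b : R) : trigcl (fun t => cos (n%:~R * t + b))
| trigcl_lin (a : R) v w : trigcl v -> trigcl w -> trigcl (fun t => a * v t + w t)
| trigcl_lim (u : nat -> R -> R) (M : R) v :
    (forall n, trigcl (u n)) -> (forall n t, Tdom t -> `|u n t| <= M) ->
    (forall t, Tdom t -> u n t @[n --> \oo] --> v t) -> trigcl v.

Lemma cvg_norm_le (u : nat -> R) (l M : R) :
  u n @[n --> \oo] --> l -> (forall n, `|u n| <= M) -> `|l| <= M.
Proof. by move=> /cvg_norm ul uM; apply: (cvgr_to_le ul); exact: nearW. Qed.

Lemma trigcl_bounded v : trigcl v ->
  exists2 M, 0 <= M & forall t, Tdom t -> `|v t| <= M.
Proof.
elim=> [n b|a {}v w _ [M M0 vM] _ [N N0 wN]|u M {}v _ _ uM uv].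
- by exists 1 => // t _; exact: cos_max.
- exists (`|a| * M + N); first by rewrite addr_ge0 ?mulr_ge0.
  move=> t Dt; apply: le_trans (ler_normD _ _) _; rewrite lerD ?wN// normrM.
  by rewrite ler_wpM2l ?vM.
- exists `|M| => // t Dt; apply: le_trans (ler_norm _).
  by apply: cvg_norm_le (uv _ Dt) _ => n; exact: uM.
Qed.

Lemma trigcl_measurable v : trigcl v -> measurable_fun Tdom v.
Proof.
elim=> [n b|a {}v w _ mv _ mw|u M {}v _ mu_ uM uv].
- exact: measurable_lin_cos.
- by apply: measurable_funD => //; apply: measurable_funM.
- exact: measurable_fun_cvg uv.
Qed.

(** A constant sequence converges on [Tdom] to any function that agrees there with its term, so
    values off [Tdom] do not matter. *)
Lemma trigcl_ext v w : trigcl w -> (forall t, Tdom t -> w t = v t) -> trigcl v.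
Proof.
move=> tw wv; have [M _ wM] := trigcl_bounded tw.
apply: (@trigcl_lim (fun=> w) M) => // t Dt.
by rewrite wv//; exact: cvg_cst.
Qed.

Lemma trigcl_cst (a : R) : trigcl (fun=> a).
Proof.
have t1 := trigcl_cos 0 0; have t0 := trigcl_lin (-1) t1 t1.
apply: trigcl_ext (trigcl_lin a t1 t0) _ => t _.
by rewrite mul0r addr0 cos0; ring.
Qed.

Lemma trigclZ (a : R) v : trigcl v -> trigcl (fun t => a * v t).
Proof.
move=> tv; apply: trigcl_ext (trigcl_lin a tv (trigcl_cst 0)) _ => t _.
by rewrite addr0.
Qed.

Lemma trigclD v w : trigcl v -> trigcl w -> trigcl (fun t => v t + w t).
Proof.
move=> tv tw; apply: trigcl_ext (trigcl_lin 1 tv tw) _ => t _.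
by rewrite mul1r.
Qed.

Lemma trigclB v w : trigcl v -> trigcl w -> trigcl (fun t => v t - w t).
Proof.
move=> tv tw; apply: trigcl_ext (trigclD tv (trigclZ (-1) tw)) _ => t _.
by rewrite mulN1r.
Qed.

Lemma trigcl_sum (n : nat) (u : nat -> R -> R) : (forall k, trigcl (u k)) ->
  trigcl (fun t => \sum_(k < n) u k t).
Proof.
move=> tu; elim: n => [|n IH].
  by apply: trigcl_ext (trigcl_cst 0) _ => t _; rewrite big_ord0.
by apply: trigcl_ext (trigclD IH (tu n)) _ => t _; rewrite big_ord_recr.
Qed.

(** Induction on [v], and on [w] when [v] is a cosine. Two cosines are multiplied by the
    product-to-sum formula; a limit in one factor passes to the product because the other factor is
    bounded. *)
Lemma trigclM v w : trigcl v -> trigcl w -> trigcl (fun t => v t * w t).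
Proof.
have limM (u : nat -> R -> R) (M : R) v' w' : trigcl w' ->
    (forall n, trigcl (fun t => u n t * w' t)) ->
    (forall n t, Tdom t -> `|u n t| <= M) ->
    (forall t, Tdom t -> u n t @[n --> \oo] --> v' t) ->
    trigcl (fun t => v' t * w' t).
  move=> tw tu uM uv; have [N N0 wN] := trigcl_bounded tw.
  apply: (@trigcl_lim (fun n t => u n t * w' t) (M * N)) => //.
  - by move=> n t Dt; rewrite normrM ler_pM ?uM ?wN.
  - by move=> t Dt; apply: cvgM; [exact: uv|exact: cvg_cst].
move=> tv; elim: tv w => [n b|a {}v v' _ IH _ IH'|u M {}v _ IH uM uv] w tw.
- elim: tw => [m b'|a {}w w' _ IH _ IH'|u M {}w tu IH uM uw].
  + have tc := trigclD (trigcl_cos (n + m) (b + b')) (trigcl_cos (n - m) (b - b')).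
    apply: trigcl_ext (trigclZ 2^-1 tc) _ => t _.
    rewrite !intrD mulrNz (_ : (_ + m%:~R) * t + _ =
      (n%:~R * t + b) + (m%:~R * t + b')); last ring.
    rewrite (_ : (n%:~R - m%:~R) * t + _ =
      (n%:~R * t + b) - (m%:~R * t + b')); last ring.
    by rewrite cosD cosB; field.
  + by apply: trigcl_ext (trigcl_lin a IH IH') _ => t _; ring.
  + apply: (trigcl_ext (w := fun t => w t * cos (n%:~R * t + b))).
      apply: limM uM uw; first exact: trigcl_cos.
      by move=> k; apply: trigcl_ext (IH k) _ => t _; rewrite mulrC.
    by move=> t _; rewrite mulrC.
- by apply: trigcl_ext (trigcl_lin a (IH _ tw) (IH' _ tw)) _ => t _; ring.
- by apply: limM uM uv => // n; exact: IH.
Qed.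

Lemma trigcl_sg v : trigcl v -> (forall t, Tdom t -> `|v t| <= 1) ->
  trigcl (fun t => Num.sg (v t)).
Proof.
move=> tv v1; apply: (@trigcl_lim (fun n t => iter n (@sgstep R) (v t)) 1).
- elim=> //= n IH; rewrite /sgstep; apply: trigclZ; apply: trigclM => //.
  by apply: trigclB; [exact: trigcl_cst|exact: trigclM].
- by move=> n t Dt; exact/iter_sgstep_norm/v1.
- by move=> t Dt; exact/iter_sgstep_cvg/v1.
Qed.

(** If [s] is the sign of [v], the indicator of [0 < v] is [(s + s ^+ 2) / 2]. *)
Lemma trigcl_pos v : trigcl v -> (forall t, Tdom t -> `|v t| <= 1) ->
  trigcl (fun t => ((0 < v t)%R)%:R).
Proof.
move=> tv v1; have ts := trigcl_sg tv v1.
apply: trigcl_ext (trigclZ 2^-1 (trigclD ts (trigclM ts ts))) _ => t _.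
by case: ltgtP => [x0|x0|<-]; rewrite ?(gtr0_sg x0) ?(ltr0_sg x0) ?sgr0/=; field.
Qed.

(* On [0, 2 pi], [sin (t / 2) sin ((x - t) / 2)] is positive exactly on ]0, x[. *)
Lemma trigcl_itv (x : R) : 0 <= x <= 2 * pi ->
  trigcl (fun t => ((0 < t < x)%R)%:R).
Proof.
move=> /andP[x0 x2]; pose v t := sin (t / 2) * sin ((x - t) / 2) : R.
(* The half-angle factors are not of the form allowed in [trigcl_cos], but their product is a cosine
   of frequency 1 up to constants. *)
have vE t : v t = 2^-1 * (cos (1%:~R * t + - (x / 2)) - cos (x / 2)).
  have e1 : cos (1%:~R * t + - (x / 2)) =
      cos (t / 2) * cos ((x - t) / 2) + sin (t / 2) * sin ((x - t) / 2).
    by rewrite -cosB; congr cos; rewrite mul1r; field.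
  have e2 : cos (x / 2) =
      cos (t / 2) * cos ((x - t) / 2) - sin (t / 2) * sin ((x - t) / 2).
    by rewrite -cosD; congr cos; field.
  by rewrite e1 e2 /v; set X := cos _ * _; set Y := sin _ * _; field.
have tv : trigcl v.
  have tc := trigclB (trigcl_cos 1 (- (x / 2))) (trigcl_cst (cos (x / 2))).
  by apply: trigcl_ext (trigclZ 2^-1 tc) _ => t _; rewrite vE.
have v1 t : Tdom t -> `|v t| <= 1.
  by move=> _; rewrite normrM mulr_ile1 ?sin_max.
apply: trigcl_ext (trigcl_pos tv v1) _ => t; rewrite /Defs.Tdom/= in_itv/= => /andP[t0 t2].
congr (_%:R); congr nat_of_bool.
have [->|tn0] := eqVneq t 0; first by rewrite /v mul0r sin0 mul0r ltxx.
have tp : 0 < t by rewrite lt_neqAle eq_sym tn0.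
rewrite tp /=; have [->|tn2] := eqVneq t (2 * pi).
  rewrite /v (_ : 2 * pi / 2 = pi); last by field.
  by rewrite sinpi mul0r ltxx; apply/esym/negbTE; rewrite -leNgt.
have t2' : t < 2 * pi by rewrite lt_neqAle tn2.
have s0 : 0 < sin (t / 2) by apply: sin_gt0_pi; apply/andP; split; lra.
rewrite /v pmulr_rgt0//; have [tx|xt] := ltP t x.
  by apply: sin_gt0_pi; apply/andP; split; lra.
apply/negbTE; rewrite -leNgt -oppr_ge0 -sinN.
by apply: sin_ge0_pi; apply/andP; split; lra.
Qed.

(** Every function in [trigcl] has equal values at 0 and 2 pi, so an indicator that separates these
    points is out of reach; intersecting with [I] removes both. *)
Definition trigset : set (set R) :=
  [set A | trigcl (fun t => \1_(A `&` I) t)].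

Lemma indicEb (A : set R) (b : bool) t : (A t <-> b) -> \1_A t = b%:R :> R.
Proof.
move=> Ab; rewrite indicE; congr (_%:R); congr nat_of_bool.
by apply/idP/idP => [/set_mem/Ab//|/Ab/mem_set].
Qed.

Lemma trigset_ray (x : R) : trigset `]-oo, x[%classic.
Proof.
have pi2 : 0 <= 2 * pi :> R by rewrite mulr_ge0 ?pi_ge0.
(* The end of the ray is clamped to [0, 2 pi], the range of [trigcl_itv]; inside [I] this does not
   change the ray. *)
rewrite /trigset/=; pose y := Num.min (Num.max 0 x) (2 * pi).
have y02 : 0 <= y <= 2 * pi.
  by rewrite /y le_min le_max lexx/= pi2 ge_min lexx orbT.
apply: trigcl_ext (trigcl_itv y02) _ => t _; apply/esym/indicEb.
rewrite /= !in_itv/= lt_min lt_max; split.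
  by move=> [tx /andP[t0 t2]]; rewrite t0 t2 tx orbT.
by move=> /andP[t0 /andP[/orP[|tx] t2]]; rewrite ?tx ?t0 ?t2//; lra.
Qed.

(** On indicators, complement is subtraction from that of [I] and finite union is [a + b - a * b]. A
    countable union is the limit of finite unions, whose indicators are eventually constant at each
    point. *)
Lemma trigset_sigma_algebra : sigma_algebra setT trigset.
Proof.
have pi2 : 0 <= 2 * pi :> R by rewrite mulr_ge0 ?pi_ge0.
have trigI : trigset setT.
  apply: trigcl_ext (@trigcl_itv (2 * pi) _) _; first by rewrite pi2 lexx.
  move=> t _; apply/esym/indicEb; rewrite setTI/= in_itv/=; by [].
have trigset0 : trigset set0.
  apply: trigcl_ext (trigcl_cst 0) _ => t _.
  by rewrite set0I indicE in_set0.
have trigsetC A : trigset A -> trigset (setT `\` A).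
  move=> tA; apply: trigcl_ext (trigclB trigI tA) _ => t _.
  rewrite !indicE !in_setI !in_setT in_setC.
  by case: (t \in A); case: (t \in _); rewrite /= ?subrr ?subr0.
have trigsetU A B : trigset A -> trigset B -> trigset (A `|` B).
  move=> tA tB; apply: trigcl_ext (trigclB (trigclD tA tB) (trigclM tA tB)) _ => t _.
  rewrite !indicE !in_setI in_setU.
  by case: (t \in A); case: (t \in B); case: (t \in _) => /=; ring.
split => // A tA; rewrite /trigset/=.
apply: (@trigcl_lim (fun n t => \1_((\big[setU/set0]_(i < n) A i) `&` I) t) 1).
- elim=> [|n IH]; first by rewrite big_ord0.
  by rewrite big_ord_recr; exact: trigsetU.
- by move=> n t _; rewrite indicE; case: (_ \in _); rewrite ?normr1 ?normr0.
- move=> t Dt; apply: cvg_near_cst.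
  have [[k _ Akt]|nA] := pselect ((\bigcup_k A k) t).
    exists k.+1 => // n /= kn; rewrite !indicE !in_setI; congr ((_ && _)%:R).
    rewrite !mem_set//; first by exists k.
    by rewrite -bigcup_mkord; exists k.
  apply: nearW => n; rewrite !indicE !in_setI; congr ((_ && _)%:R).
  rewrite !memNset//; apply: contra_not nA; exact: bigsetU_bigcup.
Qed.

Lemma trigset_measurable (A : set R) : measurable A -> trigset A.
Proof.
move=> mA; have : (@RGenInftyO.G R).-sigma.-measurable A.
  by rewrite -RGenInftyO.measurableE.
apply: smallest_sub; first exact: trigset_sigma_algebra.
by move=> _ [x ->]; exact: trigset_ray.
Qed.

(** Up to the factor [\1_I], [u n] is the integer part of [n.+1 * f] divided by [n.+1]. It is a
    combination of indicators of superlevel sets and lies within [n.+1%:R^-1] of [f]. *)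
Lemma trigcl_unit (f : R -> R) : measurable_fun Tdom f ->
  (forall t, Tdom t -> 0 <= f t <= 1) -> trigcl (fun t => f t * \1_I t).
Proof.
move=> mf f01.
pose A n k : set R := Tdom `&` [set t | k.+1%:R <= n.+1%:R * f t].
pose u n t : R := n.+1%:R^-1 * \sum_(k < n.+1) \1_(A n k `&` I) t.
have uE n t : Tdom t -> u n t =
    n.+1%:R^-1 * (\sum_(k < n.+1) ((k.+1%:R <= n.+1%:R * f t)%R)%:R) * \1_I t.
  move=> Dt; rewrite /u -mulrA big_distrl/=; congr (_ * _).
  apply: eq_bigr => k _; rewrite !indicE in_setI.
  have -> : (t \in A n k) = (k.+1%:R <= n.+1%:R * f t).
    by apply/idP/idP => [/set_mem[]//|h]; exact/mem_set.
  by case: (_ <= _); case: (t \in _); rewrite /= ?mulr0 ?mul0r ?mulr1.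
have uf n t : Tdom t -> `|f t * \1_I t - u n t| <= n.+1%:R^-1.
  move=> Dt; have /andP[f0 f1] := f01 t Dt.
  have n0 : 0 < n.+1%:R :> R by rewrite ltr0n.
  have : 0 <= n.+1%:R * f t <= n.+1%:R.
    by rewrite mulr_ge0 ?(ltW n0)//= ler_piMr ?(ltW n0).
  move=> /sum_steps; rewrite uE//; set S := \sum_(_ < _) _ => /andP[S1 S2].
  rewrite -mulrBl normrM -[leRHS]mulr1 ler_pM//; last first.
    by rewrite indicE; case: (_ \in _); rewrite ?normr1 ?normr0.
  rewrite (_ : f t - _ = n.+1%:R^-1 * (n.+1%:R * f t - S)); last first.
    by rewrite mulrBr mulKf ?gt_eqF.
  rewrite normrM ger0_norm ?invr_ge0 ?(ltW n0)// -[leRHS]mulr1.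
  rewrite ler_wpM2l ?invr_ge0 ?(ltW n0)// ler_norml.
  by apply/andP; split; lra.
(* The bound 2 allows 1 for [f] and at most 1 for the error. *)
apply: (@trigcl_lim u 2).
- move=> n; apply: trigclZ; apply: (@trigcl_sum _ (fun k t => \1_(A n k `&` I) t)) => k.
  apply: trigset_measurable; rewrite /A.
  have mnf : measurable_fun Tdom (fun t => n.+1%:R * f t) by exact: measurable_funM.
  have := mnf (@measurable_Tdom R) _ (measurable_itv (Interval (BLeft (k.+1%:R : R)) +oo%O)).
  by rewrite preimage_itvcy.
- move=> n t Dt; have fu := uf n t Dt; have /andP[f0 f1] := f01 t Dt.
  have n1 : n.+1%:R^-1 <= 1 :> R by rewrite invf_le1 ?ltr0n// ler1n.
  have fI1 : `|f t * \1_I t| <= 1.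
    have f1' : `|f t| <= 1 by rewrite ger0_norm.
    rewrite normrM mulr_ile1// indicE.
    by case: (_ \in _); rewrite ?normr1 ?normr0 ?ler01.
  rewrite -[u n t](subKr (f t * \1_I t)); apply: le_trans (ler_normB _ _) _.
  by apply: lerD fI1 (le_trans fu n1).
- move=> t Dt; apply/cvgrPdist_le => e e0.
  have /cvgr0Pnorm_le/(_ e e0) := @cvg_harmonic R.
  apply: filterS => n; rewrite /harmonic/= ger0_norm ?invr_ge0// => ne.
  exact: le_trans (uf n t Dt) ne.
Qed.

(** The bound on [f] holds only almost everywhere, so [(f + 1) / 2] is clamped to [0, 1] before
    [trigcl_unit] is applied. The clamp changes nothing where the bound holds, and the endpoints
    missing from [I] form a null set. *)
Lemma trigcl_aeeq (f : R -> R) : measurable_fun Tdom f ->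
  {ae mu, forall t, Tdom t -> `|f t| <= 1} ->
  exists2 v, trigcl v & {ae mu, forall t, Tdom t -> f t = v t}.
Proof.
move=> mf f1; pose r t := Num.max 0 (Num.min 1 (2^-1 * (f t + 1))) : R.
have mr : measurable_fun Tdom r.
  apply: measurable_maxr => //; apply: measurable_minr => //.
  by apply: measurable_funM => //; exact: measurable_funD.
have r01 t : Tdom t -> 0 <= r t <= 1.
  by move=> _; rewrite /r le_max lexx/= ge_max ler01 ge_min lexx.
exists (fun t => 2 * (r t * \1_I t) + (-1)).
  by apply: trigcl_lin; [exact: trigcl_unit|exact: trigcl_cst].
have endpts : {ae mu, forall t, Tdom t -> 0 < t < 2 * pi}.
  have neq x : {ae mu, forall t, Tdom t -> t != x}.
    exists [set x]; split; [exact: measurable_set1|exact: lebesgue_measure_set1|].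
    by move=> t /= /not_implyP[_ /negP]; rewrite negbK => /eqP.
  apply: (ae_Tdom2 _ (neq 0) (neq (2 * pi))) => t + tn0 tn2.
  rewrite /Defs.Tdom/= in_itv/= => /andP[t0 t2].
  by rewrite !lt_neqAle t0 t2 tn2 eq_sym tn0.
apply: (ae_Tdom2 _ f1 endpts) => t _; rewrite ler_norml => /andP[fN1 f1'] tI.
rewrite (indicEb (b := true)); last by rewrite /= in_itv/=; split.
have -> : r t = 2^-1 * (f t + 1).
  by rewrite /r min_r; [rewrite max_r//|]; lra.
by rewrite mulr1; field.
Qed.

End TrigClosure.

(** * Model spaces *)

Section ModelSpaces.
Variable R : realType.
Local Notation C := R[i].
Local Notation mu := (@lebesgue_measure R).
Local Notation Tdom := (@Defs.Tdom R).
Implicit Types (f h k th : bfun R) (a : C).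

Lemma inner_nsq th : inner th -> {ae mu, forall t, Tdom t -> nsq (th t) = 1}.
Proof. by move=> [_ [_]]; apply: ae_Tdom => t _ /nsq_normc. Qed.

Lemma inner_L2 th : inner th -> L2 th.
Proof. by move=> [/H2_L2]. Qed.

Lemma inner_L2M th h : inner th -> L2 h -> L2 (fun t => th t * h t).
Proof.
move=> ith; apply: (@L2M _ _ _ 1); first exact/L2_cmeas/inner_L2.
by apply: ae_Tdom (inner_nsq ith) => t _ ->.
Qed.

Lemma ip_innerM th f h : inner th -> L2 f -> L2 h ->
  ip (fun t => th t * f t) (fun t => th t * h t) = ip f h.
Proof.
move=> ith Lf Lh; apply: Tint_aeeq.
- by apply: cmeasM; [|apply: cmeasJ]; apply: L2_cmeas; exact: inner_L2M.
- by apply: cmeasM; [|apply: cmeasJ]; exact: L2_cmeas.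
- apply: ae_Tdom (inner_nsq ith) => t _ th1.
  by rewrite conjM mulrACA mulJ_nsq th1 mul1r.
Qed.

Lemma ip_inner_self th h : inner th -> L2 h ->
  ip th (fun t => th t * h t) = conjc (at0 h).
Proof.
move=> ith Lh; have -> : th = fun t => th t * 1.
  by apply/funext => t; rewrite mulr1.
under [X in ip _ X]eq_fun do rewrite mulr1.
rewrite ip_innerM//; last exact: L2_cst.
rewrite at0E -TintJ; last exact: cintegrableL2.
by congr Tint; apply/funext => t; rewrite mul1r.
Qed.

Lemma Kspace_L2 th f : Kspace th f -> L2 f.
Proof. by move=> [/H2_L2]. Qed.

Lemma KspaceB th f h : inner th -> Kspace th f -> Kspace th h ->
  Kspace th (fun t => f t - h t).
Proof.
move=> ith [Hf f0] [Hh h0]; split; first exact: H2B.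
move=> v Hv; rewrite ipB ?f0 ?h0 ?subrr//; try exact: H2_L2.
by apply: inner_L2M => //; exact: H2_L2.
Qed.

Lemma ip_chibar th f : ip f (chibar_th th) = ip (fun t => chi t * f t) th.
Proof.
by congr Tint; apply/funext => t; rewrite /chibar_th conjM conjcK; ring.
Qed.

(** Write [h] as [at0 h + chi * bshift h]. In the second term the two factors [chi] cancel, leaving
    [f] against [th * bshift h], which is zero; the first term gives the right-hand side. *)
Lemma ip_chiM_inner th f h : inner th -> Kspace th f -> H2 h ->
  ip (fun t => chi t * f t) (fun t => th t * h t) =
  conjc (at0 h) * ip f (chibar_th th).
Proof.
move=> ith Kf Hh; have Lf := Kspace_L2 Kf; have Hh' := H2_bshift Hh.
have Lthh' := inner_L2M ith (H2_L2 Hh').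
rewrite ip_chibar (_ : (fun t => th t * h t) =
    fun t => at0 h * th t + chi t * (th t * bshift h t)); last first.
  by apply/funext => t; rewrite [in LHS](bshiftE h); ring.
have Lxf : L2 (fun t => chi t * f t) by exact: L2_expiM.
rewrite ipDr ?ipZr//; [|exact: inner_L2|exact/L2Z/inner_L2|exact: L2_expiM].
rewrite [X in _ + X](_ : _ = ip f (fun t => th t * bshift h t)).
  by rewrite Kf.2// addr0.
by congr Tint; apply/funext => t; rewrite !conjM mulrACA chiJM mul1r.
Qed.

(* When [theta 0 = 0], this is the explicit form of [S_theta f]: the only
   component of [chi f] along [theta H^2] is along [theta] itself. *)
Definition cshift th f : bfun R :=
  fun t => chi t * f t - ip f (chibar_th th) * th t.

(** Against [th * h], both [chi * f] and the subtracted multiple of [th] give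
    [conjc (at0 h) * ip f (chibar_th th)]. *)
Lemma Kspace_cshift th f : inner th -> Kspace th f -> Kspace th (cshift th f).
Proof.
move=> ith Kf; have [Hf _] := Kf; have Hth := ith.1.
split; first by apply: H2B; [exact: H2_chiM|exact: H2Z].
move=> h Hh; have Lh := H2_L2 Hh; have Lthh := inner_L2M ith Lh.
rewrite ipB ?ipZ//; [|exact: H2_L2|exact/L2_expiM/H2_L2|exact/L2Z/H2_L2].
by rewrite ip_inner_self// ip_chiM_inner// mulrC subrr.
Qed.

(** The difference [d] of the two candidates lies in the model space and is a multiple of [th] minus
    the residual [chi * f - k]. Both are orthogonal to the model space, so [d] is orthogonal to
    itself. *)
Lemma is_proj_cshift th f k : inner th -> Kspace th f ->
  is_proj (Kspace th) (fun t => chi t * f t) k -> aeeq k (cshift th f).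
Proof.
move=> ith Kf [Kk kproj]; have KS := Kspace_cshift ith Kf.
have Lth := inner_L2 ith; have Lf := Kspace_L2 Kf.
pose d := fun t => k t - cshift th f t.
have Kd : Kspace th d by exact: KspaceB.
have Ld := Kspace_L2 Kd; have Lk := Kspace_L2 Kk; have LS := Kspace_L2 KS.
have Lxf : L2 (fun t => chi t * f t) by exact: L2_expiM.
have thd : ip th d = 0.
  rewrite ipJ//; have := Kd.2 _ (H2_cst 1).
  by under [X in ip _ X]eq_fun do rewrite mulr1; move=> ->; rewrite conjc0.
have dE : d = fun t => ip f (chibar_th th) * th t - (chi t * f t - k t).
  by apply/funext => t; rewrite /d /cshift; ring.
have dd : ip d d = 0.
  rewrite {1}dE ipB ?ipZ ?thd ?kproj ?mulr0 ?subrr//; [exact: L2Z|exact: L2B].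
apply: ae_Tdom (ip_eq0_aeeq Ld dd) => t _ /eqP.
by rewrite subr_eq0 => /eqP.
Qed.

(** Cancelling [th] in the pairing with [th * h] leaves the conjugate of the coefficient of [h] at
    -1. *)
Lemma Kspace_chibar th : inner th -> at0 th = 0 -> Kspace th (chibar_th th).
Proof.
move=> ith th0; split; first by apply: H2_chiJM => //; exact: ith.1.
move=> h Hh; rewrite /chibar_th.
under [X in ip X _]eq_fun do rewrite mulrC expiJ.
rewrite ip_innerM//; [|exact: L2_expi|exact: H2_L2].
rewrite ipJ; [|exact: H2_L2|exact: L2_expi].
by rewrite -fcoef_ip Hh.2// conjc0.
Qed.

(** The hypothesis is the orthogonality of 1 to [th * H2] up to conjugation; [Tint_inner_mul]
    supplies it when [at0 th = 0]. *)
Lemma Kspace_one th : inner th ->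
  (forall h, H2 h -> Tint (fun t => th t * h t) = 0) -> Kspace th (@Defs.one R).
Proof.
move=> ith th0; split; first exact: H2_cst.
move=> h Hh; rewrite ipJ; last 2 first.
- by apply: inner_L2M => //; exact: H2_L2.
- exact: L2_cst.
rewrite /ip; under eq_fun do rewrite /Defs.one conjc1 mulr1.
by rewrite th0// conjc0.
Qed.

End ModelSpaces.

(** * Inner functions vanishing at the origin *)

Section Density.
Variable R : realType.
Local Notation C := R[i].
Local Notation mu := (@lebesgue_measure R).
Local Notation Tdom := (@Defs.Tdom R).
Implicit Types (a b f h v w : bfun R).

Lemma sqnD_le f h : L2 f -> L2 h ->
  sqn (fun t => f t + h t) <= 2 * sqn f + 2 * sqn h.
Proof.
move=> Lf Lh; have fi := L2_sqn Lf; have hi := L2_sqn Lh.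
rewrite /sqn -Rintegral_lin//; apply: (@le_Rintegral _ _ _ mu _ _ _ (@measurable_Tdom R)).
- exact: (L2_sqn (L2D Lf Lh)).
- exact: integrable_lin.
- by move=> t _; exact: nsqD_le.
Qed.

Lemma sqnZ (c : C) f : L2 f -> sqn (fun t => c * f t) = nsq c * sqn f.
Proof.
move=> /L2_sqn fi; rewrite /sqn -(@RintegralZl _ _ _ mu _ _ _ (@measurable_Tdom R))//.
by apply: eq_Rintegral => t _; rewrite nsqM.
Qed.

Lemma sqn_aeeq f h : L2 f -> L2 h -> aeeq f h -> sqn f = sqn h.
Proof.
move=> Lf Lh fh; apply: Rintegral_aeeq; try by apply: measurable_nsq; exact: L2_cmeas.
by apply: ae_Tdom fh => t _ ->.
Qed.

Lemma L2_real (v : R -> R) (M : R) : measurable_fun Tdom v ->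
  (forall t, Tdom t -> `|v t| <= M) -> L2 (fun t => (v t)%:C%C).
Proof.
move=> mv vM; rewrite (_ : (fun t => _) = fun t => (v t)%:C%C * 1); last first.
  by apply/funext => t; rewrite mulr1.
apply: (@L2M _ _ _ (M ^+ 2)); last exact: L2_cst.
  by split => //; exact: measurable_cst.
apply: aeW => t Dt; rewrite /nsq/= expr0n addr0 -real_normK ?num_real//.
by rewrite lerXn2r ?nnegrE// ?vM// (le_trans (normr_ge0 _) (vM _ Dt)).
Qed.

(* The closed spans of the positive, resp. nonpositive, frequencies enter only
   through these annihilation properties. *)
Definition positive_part a :=
  [/\ H2 a, at0 a = 0 & forall h, H2 h -> Tint (fun t => a t * h t) = 0].

Definition negative_part b :=
  L2 b /\ forall f, H2 f -> at0 f = 0 -> ip f b = 0.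

Definition splits w := exists a b,
  [/\ positive_part a, negative_part b & w = fun t => a t + b t].

Lemma splits_L2 w : splits w -> L2 w.
Proof. by move=> [a [b [[/H2_L2 La _ _] [Lb _] ->]]]; exact: L2D. Qed.

Lemma positive_part_expi n : 0 < n -> positive_part (@expi R n).
Proof.
move=> n0; split; first exact/H2_expi/ltW.
- by rewrite /at0 fcoef_expi gt_eqF.
- move=> h [_ h0]; rewrite -(h0 (- n)); last by lia.
  by rewrite /fcoef opprK; congr Tint; apply/funext => t; rewrite mulrC.
Qed.

Lemma negative_part_expi n : n <= 0 -> negative_part (@expi R n).
Proof.
move=> n0; split; first exact: L2_expi.
move=> f [_ f0] fat0; rewrite -fcoef_ip.
have [->|nn0] := eqVneq n 0; first exact: fat0.
by apply: f0; rewrite lt_neqAle nn0.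
Qed.

Lemma positive_part_lin (c : C) a b : positive_part a -> positive_part b ->
  positive_part (fun t => c * a t + b t).
Proof.
move=> [Ha a0 aT] [Hb b0 bT]; have La := H2_L2 Ha; have Lb := H2_L2 Hb.
split; first by apply: H2D => //; exact: H2Z.
- by rewrite /at0 fcoefD ?fcoefZ -/(at0 a) -/(at0 b) ?a0 ?b0 ?mulr0 ?addr0//; exact: L2Z.
- move=> h Hh; have Lh := H2_L2 Hh.
  rewrite (_ : (fun t => _) = fun t => c * (a t * h t) + b t * h t); last first.
    by apply/funext => t; ring.
  have iah := cintegrableM La Lh; have ibh := cintegrableM Lb Lh.
  by rewrite TintD ?TintZ ?aT ?bT ?mulr0 ?addr0//; exact: cintegrableZ.
Qed.

Lemma negative_part_lin (c : C) a b : negative_part a -> negative_part b ->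
  negative_part (fun t => c * a t + b t).
Proof.
move=> [La aT] [Lb bT]; split; first by apply: L2D => //; exact: L2Z.
move=> f Hf f0; have Lf := H2_L2 Hf.
by rewrite ipDr ?ipZr ?aT ?bT ?mulr0 ?addr0//; exact: L2Z.
Qed.

Lemma positive_part0 : positive_part (fun=> 0).
Proof.
split; first exact: H2_cst.
- by rewrite at0E Tint_cst.
- by move=> h _; under eq_fun do rewrite mul0r; rewrite Tint_cst.
Qed.

Lemma negative_part0 : negative_part (fun=> 0).
Proof.
split; first exact: L2_cst.
move=> f _ _; rewrite /ip; under eq_fun do rewrite conjc0 mulr0.
exact: Tint_cst.
Qed.

Lemma splits_lin (c : C) w w' : splits w -> splits w' ->
  splits (fun t => c * w t + w' t).
Proof.
move=> [a [b [pa nb ->]]] [a' [b' [pa' nb' ->]]].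
exists (fun t => c * a t + a' t), (fun t => c * b t + b' t); split.
- exact: positive_part_lin.
- exact: negative_part_lin.
- by apply/funext => t; ring.
Qed.

Lemma splits_expi n : splits (@expi R n).
Proof.
have [n0|n0] := leP n 0.
- exists (fun=> 0), (expi n); split; first exact: positive_part0.
    exact: negative_part_expi.
  by apply/funext => t; rewrite add0r.
- exists (expi n), (fun=> 0); split; first exact: positive_part_expi.
    exact: negative_part0.
  by apply/funext => t; rewrite addr0.
Qed.

Lemma splits0 : splits (fun=> 0).
Proof.
exists (fun=> 0), (fun=> 0); split; first exact: positive_part0.
  exact: negative_part0.
by apply/funext => t; rewrite addr0.
Qed.

Lemma splits_cos n (b : R) : splits (fun t => (cos (n%:~R * t + b))%:C%C).
Proof.
(* Euler's formula: the coefficients of [expi n] and [expi (- n)] are $e^{ib}/2$ and $e^{-ib}/2$. *)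
have := splits_lin (Complex (2^-1 * cos b) (2^-1 * sin b)) (splits_expi n)
  (splits_lin (Complex (2^-1 * cos b) (- (2^-1 * sin b))) (splits_expi (- n)) splits0).
congr splits; apply/funext => t; rewrite -expiJ.
by apply: complexP; rewrite !ReImE/= ?cosD; field.
Qed.

Definition approximable v :=
  forall e : R, 0 < e -> exists2 w, splits w & sqn (fun t => v t - w t) < e.

Lemma approximable_lin (c : C) v v' : L2 v -> L2 v' ->
  approximable v -> approximable v' -> approximable (fun t => c * v t + v' t).
Proof.
move=> Lv Lv' av av' e e0.
(* By [sqnD_le] each error is doubled, and the first is also multiplied by [nsq c]; each then
   contributes at most [e / 2]. Adding 1 keeps the denominator positive when [c] is 0. *)
have d0 : 0 < e / (4 * (nsq c + 1)).
  by rewrite divr_gt0// mulr_gt0// ltr_wpDl// nsq_ge0.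
have [w sw vw] := av _ d0.
have [w' sw' vw'] := av' (e / 4) (divr_gt0 e0 (ltr0n _ 4)).
exists (fun t => c * w t + w' t); first exact: splits_lin.
have Lw := splits_L2 sw; have Lw' := splits_L2 sw'.
rewrite (_ : (fun t => _) = fun t => c * (v t - w t) + (v' t - w' t)); last first.
  by apply/funext => t; ring.
apply: (le_lt_trans (sqnD_le (L2Z _ (L2B Lv Lw)) (L2B Lv' Lw'))).
rewrite sqnZ; last exact: L2B.
move: vw; rewrite ltr_pdivlMr; last by rewrite mulr_gt0// ltr_wpDl// nsq_ge0.
have := sqn_ge0 (fun t => v t - w t); have := nsq_ge0 c.
set X := sqn _; set Y := sqn _ in vw' *; set Z := nsq c => Z0 X0 XZ.
by nra.
Qed.

(** Dominated convergence, the squared differences being at most [(2 * M) ^+ 2]. This turns bounded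
    pointwise limits into $L^2$ limits. *)
Lemma sqn_cvg0 (u : nat -> R -> R) (v : R -> R) (M : R) :
  (forall n, measurable_fun Tdom (u n)) -> measurable_fun Tdom v ->
  (forall n t, Tdom t -> `|u n t| <= M) ->
  (forall t, Tdom t -> u n t @[n --> \oo] --> v t) ->
  sqn (fun t => (v t)%:C%C - (u n t)%:C%C) @[n --> \oo] --> (0 : R).
Proof.
move=> mu_ mv uM uv.
have vM t : Tdom t -> `|v t| <= M.
  by move=> Dt; apply: cvg_norm_le (uv _ Dt) _ => n; exact: uM.
pose F n : R -> \bar R := EFin \o (fun t => (v t - u n t) ^+ 2).
have mF n : measurable_fun Tdom (F n).
  by apply/measurable_EFinP; apply: measurable_funX; exact: measurable_funB.
have m0 : measurable_fun Tdom (cst 0%E : R -> \bar R) by exact: measurable_cst.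
have F0 : {ae mu, forall t, Tdom t -> F n t @[n --> \oo] --> (cst 0%E : R -> \bar R) t}.
  apply: aeW => t Dt; apply: cvg_EFin; first exact: nearW.
  rewrite -[X in _ --> X](mulr0 (0 : R)).
  rewrite [X in X @ _ --> _](_ : _ = (fun n => v t - u n t) \* (fun n => v t - u n t)) //.
  have vu0 : v t - u n t @[n --> \oo] --> (0 : R).
    by rewrite -[X in _ --> X](subrr (v t)); apply: cvgB; [exact: cvg_cst|exact: uv].
  exact: cvgM.
have gi : mu.-integrable Tdom (EFin \o (fun=> (2 * M) ^+ 2)).
  have := L2_sqn (@L2_cst R (Complex (2 * M) 0)).
  by congr (mu.-integrable _ _); apply/funext => t; rewrite /= /nsq/= expr0n addr0.
have Fg : {ae mu, forall t n, Tdom t -> (`|F n t| <= (EFin \o (fun=> ((2 * M) ^+ 2)%R)) t)%E}.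
  apply: aeW => t n Dt; rewrite /= lee_fin ger0_norm ?sqr_ge0//.
  have := uM n t Dt; have := vM t Dt; rewrite !ler_norml => /andP[? ?] /andP[? ?].
  by nra.
have [_ _] := @dominated_convergence _ _ _ mu _ (@measurable_Tdom R) _ _ _ mF m0 F0 gi Fg.
rewrite integral0 => /fine_cvg; apply: cvg_trans; apply: near_eq_cvg.
apply: nearW => n; rewrite /sqn /Rintegral/=; congr fine.
by apply: eq_integral => t _; rewrite /F/= /nsq !ReImE/= subr0 expr0n addr0.
Qed.

Lemma trigcl_L2 (v : R -> R) : trigcl v -> L2 (fun t => (v t)%:C%C).
Proof.
move=> tv; have [M _ vM] := trigcl_bounded tv.
exact: L2_real (trigcl_measurable tv) vM.
Qed.

Lemma trigcl_approximable (v : R -> R) : trigcl v ->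
  approximable (fun t => (v t)%:C%C).
Proof.
elim=> [n b|c {}v w tv av tw aw|u M {}v tu au uM uv].
- move=> e e0; exists (fun t => (cos (n%:~R * t + b))%:C%C); first exact: splits_cos.
  rewrite /sqn; under eq_Rintegral do rewrite subrr.
  by rewrite (Rintegral_cst mu (@measurable_Tdom R)) /nsq/= expr0n addr0 mul0r.
- have := approximable_lin (c%:C)%C (trigcl_L2 tv) (trigcl_L2 tw) av aw.
  by congr approximable; apply/funext => t; rewrite rmorphD rmorphM.
- move=> e e0; have e4 : 0 < e / 4 by rewrite divr_gt0.
  have tv : trigcl v by exact: trigcl_lim uM uv.
  have mu_ n := trigcl_measurable (tu n).
  have := sqn_cvg0 mu_ (trigcl_measurable tv) uM uv.
  move=> /cvgrPdist_lt/(_ _ e4)/filter_ex[n].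
  rewrite sub0r normrN ger0_norm ?sqn_ge0// => vu.
  have [w sw uw] := au n _ e4; exists w => //.
  have Lw := splits_L2 sw; have Lu := trigcl_L2 (tu n); have Lv := trigcl_L2 tv.
  rewrite (_ : (fun t => _) = fun t => ((v t)%:C%C - (u n t)%:C%C) +
      ((u n t)%:C%C - w t)); last by apply/funext => t; ring.
  by apply: (le_lt_trans (sqnD_le (L2B Lv Lu) (L2B Lu Lw))); lra.
Qed.

(** The real and imaginary parts are bounded by 1 almost everywhere, so each agrees almost
    everywhere with a function of [trigcl]; the two are recombined with the coefficient $i$. *)
Lemma unimodular_approximable f : L2 f ->
  {ae mu, forall t, Tdom t -> nsq (f t) = 1} -> approximable f.
Proof.
move=> Lf f1; have [fr fi] := L2_cmeas Lf.
have [v tv fv] : exists2 v, trigcl v &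
    {ae mu, forall t, Tdom t -> complex.Re (f t) = v t}.
  apply: trigcl_aeeq => //; apply: ae_Tdom f1 => t _; rewrite /nsq => e.
  by rewrite -(@expr_le1 _ 2%N)// real_normK ?num_real//; have := sqr_ge0 (complex.Im (f t)); lra.
have [w tw fw] : exists2 v, trigcl v &
    {ae mu, forall t, Tdom t -> complex.Im (f t) = v t}.
  apply: trigcl_aeeq => //; apply: ae_Tdom f1 => t _; rewrite /nsq => e.
  by rewrite -(@expr_le1 _ 2%N)// real_normK ?num_real//; have := sqr_ge0 (complex.Re (f t)); lra.
have Lv := trigcl_L2 tv; have Lw := trigcl_L2 tw.
have av := approximable_lin (Complex 0 1) Lw Lv (trigcl_approximable tw) (trigcl_approximable tv).
move=> e /av[q sq vq]; exists q => //; apply: le_lt_trans vq.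
have Lq := splits_L2 sq.
rewrite le_eqVlt; apply/orP; left; apply/eqP; apply: sqn_aeeq.
- exact: L2B.
- by apply: L2B => //; apply: L2D => //; exact: L2Z.
- apply: (ae_Tdom2 _ fv fw) => t _ rv iw; congr (_ - _).
  by apply: complexP; rewrite !ReImE/= ?rv ?iw; ring.
Qed.

(* AM-GM with weight [s], in place of the Cauchy-Schwarz inequality. *)
Lemma Tint_mul_le f h (s : R) : 0 < s -> L2 f -> L2 h ->
  `|complex.Re (Tint (fun t => f t * h t))| <= s * sqn f + s^-1 * sqn h /\
  `|complex.Im (Tint (fun t => f t * h t))| <= s * sqn f + s^-1 * sqn h.
Proof.
move=> s0 Lf Lh; have [ir ii] := cintegrableM Lf Lh.
have fi := L2_sqn Lf; have hi := L2_sqn Lh.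
have pi1 : (2 * pi : R)^-1 <= 1.
  by rewrite invf_le1 ?mulr_gt0 ?pi_gt0//; have := pi_ge2 R; lra.
have pi0 : 0 <= (2 * pi : R)^-1 by rewrite invr_ge0 mulr_ge0 ?pi_ge0.
have amgm (x y : R) : `|x * y| <= s * x ^+ 2 + s^-1 * y ^+ 2.
  have e1 : s * x ^+ 2 + s^-1 * y ^+ 2 - 2 * (x * y) = s^-1 * (s * x - y) ^+ 2.
    by field; rewrite gt_eqF.
  have e2 : s * x ^+ 2 + s^-1 * y ^+ 2 + 2 * (x * y) = s^-1 * (s * x + y) ^+ 2.
    by field; rewrite gt_eqF.
  have p1 : 0 <= s^-1 * (s * x - y) ^+ 2 by rewrite mulr_ge0 ?sqr_ge0 ?invr_ge0 ?ltW.
  have p2 : 0 <= s^-1 * (s * x + y) ^+ 2 by rewrite mulr_ge0 ?sqr_ge0 ?invr_ge0 ?ltW.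
  by rewrite ler_norml; apply/andP; split; lra.
have main (F : R -> R) : mu.-integrable Tdom (EFin \o F) ->
    (forall t, `|F t| <= s * nsq (f t) + s^-1 * nsq (h t)) ->
    `|(2 * pi)^-1 * (\int[mu]_(t in Tdom) F t)%R| <= s * sqn f + s^-1 * sqn h.
  move=> iF Fle; rewrite normrM ger0_norm//.
  have FI : `|(\int[mu]_(t in Tdom) F t)%R| <= s * sqn f + s^-1 * sqn h.
    apply: (@le_trans _ _ (\int[mu]_(t in Tdom) `|F t|)%R).
      exact: (@le_normr_Rintegral _ _ _ mu _ _ (@measurable_Tdom R) iF).
    rewrite /sqn -Rintegral_lin//; apply: (@le_Rintegral _ _ _ mu _ _ _ (@measurable_Tdom R)).
    - exact: (integrable_abse iF).
    - exact: integrable_lin.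
    - by [].
  by apply: le_trans FI; rewrite ler_piMl.
split; apply: main => // t; rewrite ReImE.
- apply: le_trans (ler_normB _ _) _.
  have := amgm (complex.Re (f t)) (complex.Re (h t)).
  by have := amgm (complex.Im (f t)) (complex.Im (h t)); rewrite /nsq; lra.
- apply: le_trans (ler_normD _ _) _.
  have := amgm (complex.Re (f t)) (complex.Im (h t)).
  by have := amgm (complex.Im (f t)) (complex.Re (h t)); rewrite /nsq; lra.
Qed.

(* If [w = a + b] approximates [th], so does [a]: [b] is orthogonal to [th - a]. *)
Lemma Tint_inner_mul th h : inner th -> at0 th = 0 -> H2 h ->
  Tint (fun t => th t * h t) = 0.
Proof.
move=> ith th0 Hh; have Lth := inner_L2 ith; have Lh := H2_L2 Hh.
have ath := unimodular_approximable Lth (inner_nsq ith).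
have small (e : R) : 0 < e -> `|complex.Re (Tint (fun t => th t * h t))| <= e /\
    `|complex.Im (Tint (fun t => th t * h t))| <= e.
  move=> e0; have sh0 := sqn_ge0 h; set H := sqn h in sh0.
  (* This weight makes [s^-1 * H] at most [e / 2]; approximating [th] within [e / (2 * s)] then
     bounds [s * sqn d] by [e / 2] as well. *)
  pose s := 2 * (H + 1) / e.
  have s0 : 0 < s by rewrite divr_gt0// mulr_gt0// ltr_wpDl.
  have [w [a [b [[Ha a0 aT] [Lb bT] wE]]] vw] := ath (e / (2 * s)) (divr_gt0 e0 (mulr_gt0 (ltr0n _ 2) s0)).
  have La := H2_L2 Ha; have Lda := L2B Lth La.
  pose d := fun t => th t - a t.
  have Hd : H2 d := H2B ith.1 Ha.
  have d0 : at0 d = 0.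
    rewrite /at0 /d; have := fcoefD 0 Lth (L2Z (-1) La).
    rewrite fcoefZ// -/(at0 a) -/(at0 th) a0 th0 mulr0 addr0 => <-.
    by under [in RHS]eq_fun do rewrite mulN1r.
  have db : ip d b = 0 by exact: bT.
  have dle : sqn d <= sqn (fun t => th t - w t).
    have bd : ip b d = 0 by rewrite ipJ// db conjc0.
    (* Pythagoras for [th - w = d - b] with [d] orthogonal to [b]. *)
    have : ip (fun t => d t - b t) (fun t => d t - b t) = ip d d + ip b b.
      have Ldb := L2B Lda Lb; rewrite (ipB Lda Lb Ldb).
      rewrite (ipBr Lda Lda Lb) (ipBr Lb Lda Lb) -/d.
      by rewrite db bd subr0 sub0r opprK.
    rewrite !ip_sqn => -[]; rewrite -mulrDr => /(mulfI _) dE.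
    have -> : (fun t => th t - w t) = fun t => d t - b t.
      by apply/funext => t; rewrite wE /d; ring.
    rewrite dE ?lerDl ?sqn_ge0//.
    by rewrite invr_eq0 gt_eqF// mulr_gt0 ?pi_gt0.
  (* [th] may be replaced by the small function [d], because [a * h] has mean zero. *)
  have TE : Tint (fun t => th t * h t) = Tint (fun t => d t * h t).
    rewrite (_ : (fun t => th t * h t) = fun t => d t * h t + a t * h t); last first.
      by apply/funext => t; rewrite /d; ring.
    by rewrite TintD ?aT ?addr0//; exact: cintegrableM.
  have bound : s * sqn d + s^-1 * H <= e.
    have -> : e = e / 2 + e / 2 by field.
    apply: lerD.
      have := ltW (le_lt_trans dle vw).
      have s20 : 0 < 2 * s by exact: mulr_gt0.
      rewrite (ler_pdivlMr _ _ s20) => Xe; rewrite ler_pdivlMr//.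
      by rewrite (_ : s * sqn d * 2 = sqn d * (2 * s)); last ring.
    rewrite /s invf_div mulrAC ler_pdivrMr ?mulr_gt0 ?ltr_wpDl//.
    by nra.
  have [b1 b2] := Tint_mul_le s0 Lda Lh.
  by rewrite TE; split; apply: le_trans bound.
have zero (x : R) : (forall e : R, 0 < e -> `|x| <= e) -> x = 0.
  move=> xe; apply/eqP; rewrite -normr_le0; apply/ler_addgt0Pl => e e0.
  by rewrite addr0; exact: xe.
by apply: complexP; apply: zero => e /small[].
Qed.

End Density.

(** * Membership of [u] in the model space, and the intertwining relation *)

Theorem theorem3p6 (R : realType) (theta omega g g1 : bfun R) (c : R[i]) :
  inner theta -> inner omega ->
  at0 theta = 0 -> at0 omega = 0 ->
  multiplier theta omega g ->
  H2 g1 ->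
  aeeq g (fun t => omega t * conjc (theta t) * conjc (g1 t)) ->
  at0 g1 != 0 ->
  `|c| = 1 ->
  let u : bfun R := fun t =>
    omega t + (conjc (at0 g1))^-1 * (c - theta t) * g t in
  Kspace omega u /\
  (forall f k1 k2 : bfun R,
     Kspace theta f ->
     (* k1 = P_{K_theta}(chi f), so S_theta f = k1 *)
     is_proj (Kspace theta) (fun t => @chi R t * f t) k1 ->
     (* k2 = P_{K_omega}(chi (g f)), so S_omega (X f) = k2 *)
     is_proj (Kspace omega) (fun t => @chi R t * (g t * f t)) k2 ->
     (* X (U_{(theta)c} f) = T (X f) in L^2(m) *)
     aeeq (fun t => g t * Uc_val theta c f k1 t)
          (T_val omega u (fun t => g t * f t) k2)).
Proof.
move=> ith iom th0 om0 [Hg gmul] Hg1 gE a0 c1 u.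
have Lth := inner_L2 ith; have Lom := inner_L2 iom.
have Lg := H2_L2 Hg; have Lg1 := H2_L2 Hg1.
have b0 : conjc (at0 g1) != 0 by rewrite conjc_eq0.
have Kg : Kspace omega g.
  have := gmul _ (Kspace_one ith (fun h => Tint_inner_mul ith th0)).
  by under eq_fun do rewrite mulr1.
have Kgx := gmul _ (Kspace_chibar ith th0).
have thgE : (fun t => chi t * (g t * chibar_th theta t)) = fun t => theta t * g t.
  apply/funext => t; rewrite /chibar_th (_ : _ * _ =
    chi t * conjc (chi t) * (theta t * g t)); last ring.
  by rewrite chiJM mul1r.
have Hthg : H2 (fun t => theta t * g t).
  by rewrite -thgE; apply: H2_chiM; exact: Kgx.1.
have Lthg := H2_L2 Hthg.
(* Since [theta] and [omega] are unimodular, [theta * g * conjc omega] equals [conjc g1] almost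
   everywhere. This value explains the factor [(conjc (at0 g1))^-1] in [u]. *)
have thgom : ip (fun t => theta t * g t) omega = conjc (at0 g1).
  rewrite at0E -TintJ; last exact: cintegrableL2.
  apply: Tint_aeeq.
  - by apply: cmeasM; [|apply: cmeasJ]; exact: L2_cmeas.
  - exact/cmeasJ/L2_cmeas.
  - apply: (ae_Tdom2 _ (inner_nsq ith)); last first.
      exact: (ae_Tdom2 (fun t _ => @Logic.conj _ _) (inner_nsq iom) gE).
    move=> t _ th1 [om1 ->].
    rewrite (_ : _ * _ = (theta t * conjc (theta t)) *
      (omega t * conjc (omega t)) * conjc (g1 t)); last ring.
    by rewrite !mulJ_nsq th1 om1 !mul1r.
split.
  split.
    have := H2D iom.1 (H2B (H2Z ((conjc (at0 g1))^-1 * c) Hg)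
                           (H2Z (conjc (at0 g1))^-1 Hthg)).
    congr H2; apply/funext => t; rewrite /u; ring.
  move=> h Hh; have Lomh := inner_L2M iom (H2_L2 Hh).
  rewrite (_ : u = fun t => omega t + ((conjc (at0 g1))^-1 * c * g t -
      (conjc (at0 g1))^-1 * (theta t * g t))); last first.
    by apply/funext => t; rewrite /u; ring.
  rewrite ipD//; last by apply: L2B; exact: L2Z.
  rewrite ipB; [|exact: L2Z|exact: L2Z|by []].
  rewrite !ipZ// Kg.2// mulr0 sub0r ip_inner_self//; last exact: H2_L2.
  (* Seen as [chi] times an element of the model space, [theta * g] pairs with [omega * h] to
     [conjc (at0 h) * conjc (at0 g1)]. After normalization this cancels the [conjc (at0 h)] coming
     from [omega]. *)
  rewrite -thgE ip_chiM_inner// ip_chibar thgE thgom.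
  by rewrite mulrCA mulVf// mulr1 subrr.
move=> f k1 k2 Kf k1P k2P; have Lf := Kspace_L2 Kf.
have Kgf := gmul _ Kf; have Lgf := Kspace_L2 Kgf.
have ipE : ip (fun t => g t * f t) (chibar_th omega) =
    conjc (at0 g1) * ip f (chibar_th theta).
  (* The right-hand side is the pairing of [chi * f] with [theta * g1]; the integrands agree because
     [g * conjc omega] equals [conjc theta * conjc g1] almost everywhere. *)
  rewrite ip_chibar -ip_chiM_inner//; apply: Tint_aeeq.
  - by apply: cmeasM; [|apply: cmeasJ]; apply: L2_cmeas => //; exact: L2_expiM.
  - apply: cmeasM; [|apply: cmeasJ]; apply: L2_cmeas; first exact: L2_expiM.
    exact: inner_L2M.
  - apply: (ae_Tdom2 _ (inner_nsq iom) gE) => t _ om1 ->.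
    rewrite conjM (_ : _ * _ = (omega t * conjc (omega t)) *
      (chi t * f t * (conjc (theta t) * conjc (g1 t)))); last ring.
    by rewrite mulJ_nsq om1 mul1r.
apply: (ae_Tdom2 _ (is_proj_cshift ith Kf k1P) (is_proj_cshift iom Kgf k2P)).
(* Both projections are now explicit. The [omega] subtracted by the compressed shift cancels the
   [omega] in [u], and what remains is [(c - theta) * g] times [ip f (chibar_th theta)], as on the
   left. *)
move=> t _; rewrite /Uc_val /T_val /cshift ipE /u /Defs.one => -> ->.
by field.
Qed.
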